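(* For any pair $A,B\in\mathcal A^+$ with $A\le B$ there exists an integer $m_0=m_0(A,B)$ such that for any pair $\lambda_1=m_1\rho$, $\lambda_2=m_2\rho\in \check X\cap\mathcal C^+$ with integers $m_1,m_2\ge m_0$, the graphs $\widehat{\mathcal G}^{\mathrm{par}}_{|[A+\lambda_1,B+\lambda_1]}$ and $\widehat{\mathcal G}^{\mathrm{par}}_{|[A+\lambda_2,B+\lambda_2]}$ are isomorphic as oriented graphs.
   Context: $\mathfrak{g}$ is a finite-dimensional simple complex Lie algebra with roots $\Delta=\Delta_+\sqcup\Delta_-$ and simple roots $\Pi$ (w.r.t. fixed $\mathfrak b\supseteq\mathfrak h$). Via an invariant form $(\cdot,\cdot)$ on $\mathfrak h_{\mathbb R}^*$ (real span of $\Pi$) identify $\alpha^\vee=2\alpha/(\alpha,\alpha)$. $\check X=\{\lambda\in\mathfrak h^*_{\mathbb R}:(\lambda,\alpha)\in\mathbb Z\ \forall\alpha\in\Delta\}$ is the lattice of finite integral coweights; $\rho=\frac12\sum_{\alpha\in\Delta_+}\alpha^\vee$. The affine Weyl group $\widehat{\mathcal W}$ acts on $\mathfrak h^*_{\mathbb R}$, generated by $s_{\alpha+n\delta}(\lambda)=s_\alpha(\lambda)-n\alpha^\vee$ for $\alpha+n\delta\in\widehat\Delta_+^{\mathrm{re}}=\{\alpha+n\delta:\alpha\in\Delta,n\in\mathbb Z_{>0}\}\cup\Delta_+$; $\mathcal W$ is the finite Weyl group. Alcoves are the connected components of $\mathfrak h_{\mathbb R}^*$ minus all hyperplanes $\{(\lambda,\alpha)=-n\}$;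 $\mathcal C^+=\{\lambda:\langle\lambda,\alpha^\vee\rangle>0\ \forall\alpha\in\Pi\}$; $\mathcal A^+$ is the set of alcoves in $\mathcal C^+$, $A^+\in\mathcal A^+$ the one with $0$ in its closure. Alcoves correspond bijectively to $\widehat{\mathcal W}$ via $w\mapsto wA^+$, and the Bruhat order is transported: $xA^+\le yA^+\iff x\le y$. The parabolic Bruhat graph $\widehat{\mathcal G}^{\mathrm{par}}$ has vertex set $\mathcal A^+$ with the Bruhat order; distinct $xA^+,yA^+\in\mathcal A^+$ are joined by an edge, oriented towards the larger vertex, iff there are $w\in\mathcal W$, $\alpha\in\widehat\Delta_+^{\mathrm{re}}$ with $x=wys_\alpha$ (labels are disregarded here). $[C,D]$ denotes the interval in $(\mathcal A^+,\le)$ and the subscript $|[C,D]$ the full subgraph on it. $A+\lambda$ is the translate of the alcove $A$ by $\lambda\in\check X$. *)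

(* Defs.v *)
From HB Require Import structures.
From mathcomp Require Import all_boot all_order all_algebra finmap.
From mathcomp Require Import sesquilinear.
From mathcomp Require Import boolp classical_sets functions reals.
From mathcomp Require Import topology normedtype.
Import numFieldNormedType.Exports.

Set Implicit Arguments.
Unset Strict Implicit.
Unset Printing Implicit Defensive.

Import Order.TTheory GRing.Theory Num.Theory.
Local Open Scope classical_set_scope.
Local Open Scope ring_scope.

(* The root data of a simple complex Lie algebra of rank n with a chosen Borel
   subalgebra, i.e. an irreducible reduced crystallographic root system with a
   base.  The real span of the roots is 'rV[R]_n, in arbitrary coordinates, so
   [inner] is an arbitrary inner product; its invariance under the finite Weyl
   group holds because the reflections below are the [inner]-orthogonal ones.
   Coroots live in the same space: alpha^vee = 2 alpha / (alpha, alpha). *)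
Record rootData (R : realType) (n : nat) := RootData {
  inner : {dot 'rV[R]_n for idfun} ;
  Delta : {fset 'rV[R]_n} ;
  simples : n.-tuple 'rV[R]_n ;
  Delta_neq0 : 0 \notin Delta ;
  Delta_stable : forall a b, a \in Delta -> b \in Delta ->
    b - (2 * inner b a / inner a a) *: a \in Delta ;
  Delta_crystallographic : forall a b, a \in Delta -> b \in Delta ->
    2 * inner b a / inner a a \is a Num.int ;
  Delta_reduced : forall a (c : R), a \in Delta -> c *: a \in Delta ->
    c = 1 \/ c = -1 ;
  Delta_nonempty : Delta != fset0 ;
  Delta_irreducible : forall S : {fset 'rV[R]_n}, (S `<=` Delta)%fset ->
    (forall a b, a \in S -> b \in (Delta `\` S)%fset -> inner a b = 0) ->
    S = fset0 \/ S = Delta ;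
  simples_basis : basis_of fullv simples ;
  simples_Delta : {subset simples <= Delta} ;
  simples_base : forall a, a \in Delta -> exists c : 'I_n -> nat,
    a = \sum_(i < n) simples`_i *+ c i \/
    a = - \sum_(i < n) simples`_i *+ c i
}.

Section RootData.
Variables (R : realType) (n : nat) (D : rootData R n).

Local Notation V := 'rV[R]_n.
Local Notation "''(' x , y )" := (inner D x y) (format "''(' x ,  y )").

Definition coroot (a : V) : V := (2 / '(a, a)) *: a.

Definition nonneg_coords (v : V) : bool :=
  [forall i, 0 <= coord (simples D) i v].

Definition pos_root (a : V) : bool := (a \in Delta D) && nonneg_coords a.

Definition rho : V := 2^-1 *: \sum_(a <- Delta D | pos_root a) coroot a.

Definition coweight : set V :=
  [set l | forall a, a \in Delta D -> '(l, a) \is a Num.int].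

Definition dom_chamber : set V :=
  [set l | forall a, a \in simples D -> 0 < '(l, coroot a)].

(* The real affine root alpha + k delta is encoded as the pair (alpha, k). *)
Definition aff_pos_root (r : V * int) : bool :=
  (r.1 \in Delta D) && (0 < r.2) || pos_root r.1 && (r.2 == 0).

Definition aff_refl (r : V * int) (l : V) : V :=
  l - '(l, r.1) *: coroot r.1 - coroot r.1 *~ r.2.

Definition fin_refl (a : V) : V -> V := aff_refl (a, 0).

(* As reflections are involutions, the group generated by a set of them
   consists of the products of finite words in this set. *)
Definition word_prod (ws : seq (V * int)) : V -> V :=
  foldr (fun r f => aff_refl r \o f) id ws.

Definition aff_weyl : set (V -> V) :=
  [set w | exists2 ws, all aff_pos_root ws & w = word_prod ws].

Definition fin_weyl : set (V -> V) :=
  [set w | exists2 s : seq V, {subset s <= Delta D} &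
           w = foldr (fun a f => fin_refl a \o f) id s].

Definition highest_root (a : V) : bool :=
  (a \in Delta D) && all (fun b => nonneg_coords (a - b)) (Delta D).

Definition aff_simple_root (r : V * int) : bool :=
  (r.1 \in simples D) && (r.2 == 0) || highest_root (- r.1) && (r.2 == 1).

Definition has_simple_word (w : V -> V) (k : nat) : Prop :=
  exists ws, [/\ size ws = k, all aff_simple_root ws & w = word_prod ws].

(* Coxeter length with respect to the simple affine reflections. *)
Definition aff_length (w : V -> V) : nat :=
  xget 0%N [set k | has_simple_word w k /\
                    forall j, has_simple_word w j -> (k <= j)%N].

Inductive bruhat_le (x : V -> V) : (V -> V) -> Prop :=
| bruhat_refl : bruhat_le x x
| bruhat_step y r : bruhat_le x y -> aff_pos_root r ->
    (aff_length y < aff_length (y \o aff_refl r))%N ->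
    bruhat_le x (y \o aff_refl r).

Definition hyperplanes_compl : set V :=
  [set l | forall a (k : int), a \in Delta D -> '(l, a) != - k%:~R].

Definition alcove (A : set V) : Prop :=
  exists2 l, hyperplanes_compl l & A = connected_component hyperplanes_compl l.

Definition dom_alcove : set (set V) :=
  [set A | alcove A /\ A `<=` dom_chamber].

Definition fund_alcove : set V :=
  xget set0 [set A | dom_alcove A /\ closure A 0].

Definition alcove_of (w : V -> V) : set V := w @` fund_alcove.

Definition alcove_le (A B : set V) : Prop :=
  exists x y, [/\ aff_weyl x, aff_weyl y, A = alcove_of x, B = alcove_of y &
                  bruhat_le x y].

Definition alcove_itv (A B : set V) : set (set V) :=
  [set E | [/\ dom_alcove E, alcove_le A E & alcove_le E B]].

Definition translate (l : V) (A : set V) : set V := [set a + l | a in A].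

Definition par_joined (A B : set V) : Prop :=
  A <> B /\
  exists x y, [/\ aff_weyl x, aff_weyl y, A = alcove_of x, B = alcove_of y &
    exists w r, [/\ fin_weyl w, aff_pos_root r & x = w \o y \o aff_refl r]].

(* The edge A -> B of the parabolic Bruhat graph, for A and B in dom_alcove. *)
Definition par_edge (A B : set V) : Prop := par_joined A B /\ alcove_le A B.

End RootData.

(* Isomorphism between the full subgraphs on the vertex sets X and Y of an
   oriented graph without multiple edges, with edge relation e. *)
Definition full_subgraph_iso (T : Type) (e : T -> T -> Prop) (X Y : set T) :=
  exists2 f : T -> T, set_bij X Y f &
    forall u v, X u -> X v -> (e u v <-> e (f u) (f v)).

(* Main.v *)
Require Import Defs.
From mathcomp Require Import all_boot all_order all_algebra finmap.
From mathcomp Require Import sesquilinear.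
From mathcomp Require Import boolp classical_sets functions reals.
From mathcomp Require Import topology normedtype.
From mathcomp Require Import zify ring lra.
Set Implicit Arguments.
Unset Strict Implicit.
Unset Printing Implicit Defensive.
Import Order.TTheory GRing.Theory Num.Theory.
Import numFieldNormedType.Exports.
Local Open Scope classical_set_scope.
Local Open Scope ring_scope.

(** Deep in the dominant chamber the Bruhat order and the edges of the parabolic
    Bruhat graph become invariant under translation by multiples of [rho], so
    that the translation by [l2 - l1] is the required isomorphism.

    The order. Reflecting an alcove in a hyperplane raises it in the Bruhat order
    exactly when the hyperplane does not separate it from the fundamental alcove;
    this is the exchange property ([exchange], [aff_length_refl]), for which the
    affine Weyl group must be known to be generated by the simple affine
    reflections ([refl_simple_word]), the existence of the highest root included
    ([highest_root_exists]). So the Bruhat order is the case of the fundamental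
    alcove in a family of orders [ale p], one for each base alcove
    ([alcove_leP]). Translating two alcoves by [mu] amounts to translating the
    base by [- mu]. By a lifting argument, the base may cross a wall when the
    larger alcove is on the side that the base leaves ([ale_cross_up],
    [ale_base]); for [mu] dominant and a dominant alcove, this is the case for
    all the walls to be crossed ([ale_translate]). Hence the relation between the
    translates of two given alcoves by [m rho] is monotone in [m], and it is
    eventually constant ([monotone_stabilizes]).

    Finiteness. Along the Bruhat order, the dominant representatives of points
    increase by nonnegative combinations of simple roots ([ale_fold]). So each
    alcove of the interval from [A + m rho] to [B + m rho] contains a point
    between a point of [A + m rho] and a point of [B + m rho] for the dominance
    order, and its translate by [- m rho] belongs to a finite set that does not
    depend on [m] ([interval_bounded], [finitely_many_cells]). A single threshold
    thus works for all the pairs of alcoves involved.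

    The edges. Two alcoves are joined when one is [w s] applied to the other, with
    [w] in the finite Weyl group and [s] an affine reflection ([par_joinedP]). For
    two alcoves of the finite set, translated by [m rho], the vector
    [m (rho - w rho)] is then at bounded distance from a line spanned by a root.
    For [m] large this forces [w] to be trivial or the reflection for which [w s]
    is a translation ([joined_far]). Being related in either of these ways is
    invariant under translation by coweights ([joined_translate]). *)

(** * Reflections and affine roots *)

Section InnerProduct.
Variables (R : realType) (n : nat) (D : rootData R n).
Local Notation V := 'rV[R]_n.
Local Notation "''(' x , y )" := (inner D x y : R) (format "''(' x ,  y )").

Lemma ipC (x y : V) : '(x, y) = '(y, x).
Proof. by rewrite hermC /= expr0 mul1r. Qed.

Lemma ipDl (x y z : V) : '(x + y, z) = '(x, z) + '(y, z).
Proof. exact: linearDl. Qed.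

Lemma ipDr (x y z : V) : '(x, y + z) = '(x, y) + '(x, z).
Proof. by rewrite ipC ipDl !(ipC x). Qed.

Lemma ipZl (c : R) (x y : V) : '(c *: x, y) = c * '(x, y).
Proof. exact: linearZl_LR. Qed.

Lemma ipZr (c : R) (x y : V) : '(x, c *: y) = c * '(x, y).
Proof. by rewrite ipC ipZl ipC. Qed.

Lemma ipNl (x y : V) : '(- x, y) = - '(x, y).
Proof. by rewrite -scaleN1r ipZl mulN1r. Qed.

Lemma ipNr (x y : V) : '(x, - y) = - '(x, y).
Proof. by rewrite ipC ipNl ipC. Qed.

Lemma ipBl (x y z : V) : '(x - y, z) = '(x, z) - '(y, z).
Proof. by rewrite ipDl ipNl. Qed.

Lemma ipBr (x y z : V) : '(x, y - z) = '(x, y) - '(x, z).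
Proof. by rewrite ipDr ipNr. Qed.

Lemma ip0l (x : V) : '(0, x) = 0.
Proof. by rewrite -[X in inner D X _](scale0r x) ipZl mul0r. Qed.

Lemma ip_suml (I : Type) (s : seq I) (P : pred I) (F : I -> V) y :
  '(\sum_(i <- s | P i) F i, y) = \sum_(i <- s | P i) '(F i, y).
Proof.
by apply: (big_morph (fun x => '(x, y)) (fun a b => ipDl a b y) (ip0l y)).
Qed.

Lemma ip_sumr (I : Type) (s : seq I) (P : pred I) (F : I -> V) y :
  '(y, \sum_(i <- s | P i) F i) = \sum_(i <- s | P i) '(y, F i).
Proof. by rewrite ipC ip_suml; apply: eq_bigr => i _; rewrite ipC. Qed.

Lemma ip_gt0 (x : V) : x != 0 -> 0 < '(x, x).
Proof. exact: neq0_dnorm_gt0. Qed.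

Lemma ip_ge0 (x : V) : 0 <= '(x, x).
Proof.
by have [->|x0] := eqVneq x 0; [rewrite ip0l | exact/ltW/ip_gt0].
Qed.

Lemma ip_eq0 (x : V) : '(x, x) = 0 -> x = 0.
Proof.
move=> xx; apply/eqP/negPn/negP => /ip_gt0.
by rewrite xx ltxx.
Qed.

Lemma root_neq0 a : a \in Delta D -> a != 0.
Proof.
by move=> aD; apply/eqP => a0; move: (Delta_neq0 D); rewrite -a0 aD.
Qed.

Lemma root_gt0 a : a \in Delta D -> 0 < '(a, a).
Proof. by move=> /root_neq0; apply: ip_gt0. Qed.

Lemma simple_root i : (i < n)%N -> (simples D)`_i \in Delta D.
Proof. by move=> lt_in; apply: simples_Delta; rewrite mem_nth ?size_tuple. Qed.

(** The linear reflection in the direction [a], which is the linear part of all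
    the affine reflections in this direction. *)
Definition lrefl (a v : V) : V := v - '(v, a) *: coroot D a.

Lemma corootN a : coroot D (- a) = - coroot D a.
Proof. by rewrite /coroot ipNl ipNr opprK scalerN. Qed.

Lemma ip_coroot a v : '(coroot D a, v) = 2 * '(v, a) / '(a, a).
Proof. by rewrite ipZl ipC; ring. Qed.

Lemma ip_coroot_self a : a != 0 -> '(coroot D a, a) = 2.
Proof.
by move=> a0; have := ip_gt0 a0; move=> {}a0; rewrite ip_coroot mulfK // gt_eqF.
Qed.

Lemma lreflE a v : lrefl a v = v - '(coroot D a, v) *: a.
Proof.
by rewrite /lrefl ip_coroot /coroot scalerA; congr (_ - _ *: _); ring.
Qed.

Lemma lreflD a u v : lrefl a (u + v) = lrefl a u + lrefl a v.
Proof. by rewrite /lrefl ipDl scalerDl opprD addrACA. Qed.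

Lemma lreflZ a c v : lrefl a (c *: v) = c *: lrefl a v.
Proof. by rewrite /lrefl ipZl scalerBr -scalerA. Qed.

Lemma lreflN a v : lrefl a (- v) = - lrefl a v.
Proof. by rewrite -scaleN1r lreflZ scaleN1r. Qed.

Lemma lreflB a u v : lrefl a (u - v) = lrefl a u - lrefl a v.
Proof. by rewrite lreflD lreflN. Qed.

Lemma lreflK a : a \in Delta D -> involutive (lrefl a).
Proof.
move=> /root_neq0 a0 v; have va : '(lrefl a v, a) = - '(v, a).
  by rewrite /lrefl ipBl ipZl ip_coroot_self //; ring.
by rewrite [LHS]/lrefl va scaleNr opprK subrK.
Qed.

Lemma lrefl_isom a u v : a \in Delta D -> '(lrefl a u, lrefl a v) = '(u, v).
Proof.
move=> aD; have aa := root_gt0 aD.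
rewrite !lreflE !ip_coroot !ipBl !ipBr !ipZl !ipZr (ipC a v).
field; exact: lt0r_neq0.
Qed.

Lemma lrefl_root a b : a \in Delta D -> b \in Delta D ->
  lrefl a b \in Delta D.
Proof. by move=> aD bD; rewrite lreflE ip_coroot; exact: Delta_stable. Qed.

Lemma lrefl_self a : a != 0 -> lrefl a a = - a.
Proof.
move=> a0; rewrite lreflE ip_coroot_self // -[2]/(1+1) scalerDl scale1r.
by rewrite opprD addNKr.
Qed.

Lemma oppr_root a : a \in Delta D -> - a \in Delta D.
Proof.
by move=> aD; rewrite -lrefl_self ?root_neq0 //; exact: lrefl_root.
Qed.

Lemma coroot_lrefl b a : b \in Delta D ->
  coroot D (lrefl b a) = lrefl b (coroot D a).
Proof. by move=> bD; rewrite /coroot lrefl_isom // lreflZ. Qed.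

Lemma cart_int a b : a \in Delta D -> b \in Delta D ->
  '(coroot D a, b) \is a Num.int.
Proof. by move=> aD bD; rewrite ip_coroot; exact: Delta_crystallographic. Qed.

(** The value at [l] of the affine function of an affine root, so that [r]
    vanishes on its reflecting hyperplane. *)
Definition rval (r : V * int) (l : V) : R := '(l, r.1) + r.2%:~R.

Lemma aff_reflE r l : aff_refl D r l = l - rval r l *: coroot D r.1.
Proof. by rewrite /aff_refl /rval scalerDl opprD addrA scaler_int. Qed.

Lemma aff_reflDr r l v : aff_refl D r (l + v) = aff_refl D r l + lrefl r.1 v.
Proof.
rewrite !aff_reflE /rval /lrefl ipDl; move: (coroot D r.1) => c.
by apply/rowP => i; rewrite !mxE; ring.
Qed.

Lemma rval_refl r l : r.1 \in Delta D ->
  rval r (aff_refl D r l) = - rval r l.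
Proof.
move=> /root_neq0 r0; rewrite {1}/rval aff_reflE ipBl ipZl.
by rewrite ip_coroot_self // /rval; ring.
Qed.

Lemma aff_reflK r : r.1 \in Delta D -> involutive (aff_refl D r).
Proof.
by move=> rD l; rewrite aff_reflE rval_refl // aff_reflE scaleNr opprK subrK.
Qed.

(** The image of the affine root [r] under the reflection of [q],
    characterized by [rval_act]. The integer part takes the integer [(coroot q.1, r.1)] from the
    reals to [int]. *)
Definition act (q r : V * int) : V * int :=
  (lrefl q.1 r.1, r.2 - q.2 * Num.floor '(coroot D q.1, r.1)).

Lemma act_root q r : q.1 \in Delta D -> r.1 \in Delta D ->
  (act q r).1 \in Delta D.
Proof. exact: lrefl_root. Qed.

Lemma rval_act q r l : q.1 \in Delta D -> r.1 \in Delta D ->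
  rval (act q r) l = rval r (aff_refl D q l).
Proof.
move=> qD rD; rewrite /rval /act /= aff_reflE ipBl ipZl lreflE.
rewrite ipBr ipZr rmorphB rmorphM /= (floorK (cart_int qD rD)).
by rewrite /rval; ring.
Qed.

Lemma aff_refl_act q r l : q.1 \in Delta D -> r.1 \in Delta D ->
  aff_refl D (act q r) l = aff_refl D q (aff_refl D r (aff_refl D q l)).
Proof.
move=> qD rD; rewrite aff_reflE rval_act // [in RHS](aff_reflE r).
rewrite aff_reflDr aff_reflK //=.
by rewrite lreflN lreflZ coroot_lrefl.
Qed.

(** The affine root opposite to [r]; both define the same reflection. *)
Definition oppr_aff (r : V * int) : V * int := (- r.1, - r.2).

Lemma rvalN r l : rval (oppr_aff r) l = - rval r l.
Proof. by rewrite /rval ipNr rmorphN opprD. Qed.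

Lemma aff_reflN r : aff_refl D (oppr_aff r) = aff_refl D r.
Proof.
by apply/funext => l; rewrite !aff_reflE rvalN corootN scalerN scaleNr opprK.
Qed.

End InnerProduct.

(** * Coordinates in the base of simple roots *)

Section Coordinates.
Variables (R : realType) (n : nat) (D : rootData R n).
Local Notation V := 'rV[R]_n.
Local Notation "''(' x , y )" := (inner D x y : R) (format "''(' x ,  y )").
Local Notation sr i := ((simples D)`_(i : 'I_n)).

(** The coordinates of a vector in the base of simple roots. *)
Definition cd (i : 'I_n) (v : V) : R := coord (simples D) i v.

Lemma cdD i u v : cd i (u + v) = cd i u + cd i v.
Proof. exact: linearD. Qed.

Lemma cdN i v : cd i (- v) = - cd i v.
Proof. exact: linearN. Qed.

Lemma cdB i u v : cd i (u - v) = cd i u - cd i v.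
Proof. exact: linearB. Qed.

Lemma cdZ i c v : cd i (c *: v) = c * cd i v.
Proof. exact: linearZ. Qed.

Lemma cd0 i : cd i 0 = 0.
Proof. exact: linear0. Qed.

Lemma cd_sum i (J : Type) (s : seq J) (P : pred J) (F : J -> V) :
  cd i (\sum_(j <- s | P j) F j) = \sum_(j <- s | P j) cd i (F j).
Proof. exact: linear_sum. Qed.

Lemma cdMn i v k : cd i (v *+ k) = cd i v *+ k.
Proof. exact: linearMn. Qed.

Lemma coordE (v : V) : v = \sum_i cd i v *: sr i.
Proof. exact: (coord_basis (simples_basis D) (memvf v)). Qed.

Lemma coord_simple i j : cd i (sr j) = (i == j)%:R.
Proof.
by rewrite eq_sym; exact: (coord_free j i (basis_free (simples_basis D))).
Qed.

Lemma srD i : sr i \in Delta D.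
Proof. exact: simple_root. Qed.

Lemma sr_mem i : sr i \in simples D.
Proof. by rewrite mem_nth ?size_tuple. Qed.

Lemma srP a : a \in simples D -> exists i : 'I_n, a = sr i.
Proof.
move=> /(nthP 0)[i]; rewrite size_tuple => lt_in <-.
by exists (Ordinal lt_in).
Qed.

Lemma coord_eq0 (v : V) : (forall i, cd i v = 0) -> v = 0.
Proof.
by move=> v0; rewrite (coordE v) big1 // => i _; rewrite v0 scale0r.
Qed.

Lemma nonnegP (v : V) : reflect (forall i, 0 <= cd i v) (nonneg_coords D v).
Proof. exact: forallP. Qed.

Lemma nonnegD (u v : V) : nonneg_coords D u -> nonneg_coords D v ->
  nonneg_coords D (u + v).
Proof.
by move=> /nonnegP u0 /nonnegP v0; apply/nonnegP => i; rewrite cdD addr_ge0.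
Qed.

Lemma nonnegZ (c : R) (v : V) : 0 <= c -> nonneg_coords D v ->
  nonneg_coords D (c *: v).
Proof.
by move=> c0 /nonnegP v0; apply/nonnegP => i; rewrite cdZ mulr_ge0.
Qed.

Lemma nonneg0 : nonneg_coords D 0.
Proof. by apply/nonnegP => i; rewrite cd0. Qed.

Lemma nonneg_trans (u v w : V) : nonneg_coords D (v - u) ->
  nonneg_coords D (w - v) -> nonneg_coords D (w - u).
Proof. by move=> uv vw; rewrite -(subrKA v w (- u)) nonnegD. Qed.

Lemma nonneg_anti (v : V) :
  nonneg_coords D v -> nonneg_coords D (- v) -> v = 0.
Proof.
move=> /nonnegP v0 /nonnegP v1; apply: coord_eq0 => i; apply: le_anti.
by rewrite v0 andbT; have := v1 i; rewrite cdN oppr_ge0.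
Qed.

Lemma nonneg_simple i : nonneg_coords D (sr i).
Proof. by apply/nonnegP => j; rewrite coord_simple ler0n. Qed.

Lemma root_sign a : a \in Delta D -> nonneg_coords D a || nonneg_coords D (- a).
Proof.
move=> /simples_base [c ac]; apply/orP.
have pos : nonneg_coords D (\sum_(i < n) sr i *+ c i).
  apply/nonnegP => i; rewrite cd_sum sumr_ge0 // => j _.
  by rewrite cdMn coord_simple mulrn_wge0 // ler0n.
by case: ac => ->; [left | right; rewrite opprK].
Qed.

Lemma root_nonneg a i : a \in Delta D -> 0 < cd i a -> nonneg_coords D a.
Proof.
move=> /root_sign/orP[] // /nonnegP/(_ i); rewrite cdN oppr_ge0 => a0.
by rewrite ltNge a0.
Qed.

Lemma coord_lrefl i j v :
  cd j (lrefl D (sr i) v) = cd j v - '(coroot D (sr i), v) * (j == i)%:R.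
Proof. by rewrite lreflE cdB cdZ /= coord_simple. Qed.

Lemma simples_obtuse i j : i != j -> '(sr i, sr j) <= 0.
Proof.
move=> ij; have rD : lrefl D (sr i) (sr j) \in Delta D by rewrite lrefl_root ?srD.
have /nonnegP/(_ i) : nonneg_coords D (lrefl D (sr i) (sr j)).
  apply: (@root_nonneg _ j) => //; rewrite coord_lrefl coord_simple eqxx.
  by rewrite eq_sym (negbTE ij) mulr0 subr0.
rewrite coord_lrefl coord_simple (negbTE ij) eqxx mulr1 sub0r oppr_ge0.
rewrite ip_coroot pmulr_lle0 ?invr_gt0 ?root_gt0 ?srD //.
by rewrite pmulr_rle0 ?ltr0n // ipC.
Qed.

Lemma ip_coord u v : '(u, v) = \sum_i cd i u * '(sr i, v).
Proof.
by rewrite {1}(coordE u) ip_suml; apply: eq_bigr => i _; rewrite ipZl.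
Qed.

Lemma ip_pos_simple v : nonneg_coords D v -> v != 0 ->
  exists2 i, 0 < cd i v & 0 < '(sr i, v).
Proof.
move=> /nonnegP v0 /(ip_gt0 D) vv; apply: contrapT => no.
suff : '(v, v) <= 0 by rewrite leNgt vv.
rewrite ip_coord sumr_le0 // => i _.
have [iv|iv] := ltP 0 (cd i v); last first.
  have -> : cd i v = 0 by apply: le_anti; rewrite iv v0.
  by rewrite mul0r.
rewrite pmulr_rle0 // leNgt; apply/negP => siv; apply: no; by exists i.
Qed.

(** As roots are reduced, a positive root on the line of a simple root is this
    simple root. *)
Lemma root_multiple a i : a \in Delta D -> nonneg_coords D a ->
  (forall j, j != i -> cd j a = 0) -> a = sr i.
Proof.
move=> aD /nonnegP a0 az.
have aE : a = cd i a *: sr i.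
  rewrite {1}(coordE a) (bigD1 i) //= big1 ?addr0 // => j ji.
  by rewrite az // scale0r.
have ciD : cd i a *: sr i \in Delta D by rewrite -aE.
have [c1|c1] := Delta_reduced (srD i) ciD.
  by rewrite aE c1 scale1r.
by have := a0 i; rewrite c1 oppr_ge0 lt_geF ?ltr01.
Qed.

(** The height of a vector: the sum of its coordinates in the base. *)
Definition height (v : V) : R := \sum_i cd i v.

Lemma heightB u v : height (u - v) = height u - height v.
Proof.
by rewrite /height -sumrB; apply: eq_bigr => i _; rewrite cdB.
Qed.

Lemma height_ge0 v : nonneg_coords D v -> 0 <= height v.
Proof. by move=> /nonnegP v0; apply: sumr_ge0. Qed.

Lemma height_eq0 v : nonneg_coords D v -> height v <= 0 -> v = 0.
Proof.
move=> /nonnegP v0 h0; apply: coord_eq0 => i; apply/eqP.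
have : height v == 0 by rewrite eq_le h0 height_ge0 //; apply/nonnegP.
by rewrite psumr_eq0 => [/allP/(_ i (mem_index_enum i))|].
Qed.

Lemma height_simple i : height (sr i) = 1.
Proof.
rewrite /height (bigD1 i) //= coord_simple eqxx big1 ?addr0 // => j ji.
by rewrite coord_simple (negbTE ji).
Qed.

Lemma height_lrefl i v :
  height (lrefl D (sr i) v) = height v - '(coroot D (sr i), v).
Proof.
rewrite lreflE heightB; congr (_ - _).
rewrite -[RHS]mulr1 -(height_simple i) /height mulr_sumr.
by apply: eq_bigr => j _; rewrite cdZ.
Qed.

Lemma ip_coroot_gt0 a v : a \in Delta D -> (0 < '(coroot D a, v)) = (0 < '(a, v)).
Proof.
move=> aD; rewrite ip_coroot pmulr_lgt0 ?invr_gt0 ?root_gt0 //.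
by rewrite pmulr_rgt0 ?ltr0n // ipC.
Qed.

(** If two parts of the base are orthogonal to each other then no root has
    support in both of them. *)
Lemma support_split (K : pred 'I_n) b : b \in Delta D -> nonneg_coords D b ->
  (forall i j, K i -> ~~ K j -> '(sr i, sr j) = 0) ->
  (forall i, K i -> cd i b = 0) \/ (forall i, ~~ K i -> cd i b = 0).
Proof.
have noti : forall v j, nonneg_coords D v -> cd j v <> 0 -> 0 < cd j v.
  by move=> v j /nonnegP v0 /eqP; rewrite lt_def v0 andbT.
move=> bD b0; move: (archi_boundP (height_ge0 b0)); move: (Num.bound _) => N.
elim: N b K bD b0 => [|N IHN] b K bD b0 hb orth.
  by have := height_ge0 b0; rewrite leNgt hb.
apply: contrapT => /not_orP[/existsNP[i0 /not_implyP[Ki0 bi0]]].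
move=> /existsNP[j0 /not_implyP[Kj0 bj0]].
have [i bi0' bi] := ip_pos_simple b0 (root_neq0 bD).
(* the part of the base containing [i] may be taken to be [K] *)
wlog Ki : K i0 j0 Ki0 bi0 Kj0 bj0 orth / K i.
  move=> W; have [Ki|Ki] := boolP (K i); first exact: (W K i0 j0).
  apply: (W (predC K) j0 i0) => //=; first by rewrite negbK.
  by move=> k l Kk; rewrite negbK => Kl; rewrite ipC orth.
set c := '(coroot D (sr i), b).
have c1 : 1 <= c.
  have cZ : c \is a Num.int by rewrite cart_int ?srD.
  have : 0 < c by rewrite ip_coroot_gt0 ?srD.
  by rewrite -(floorK cZ) ltr0z ler1z; lia.
have ij0 : (j0 == i) = false by apply: contraNF Kj0 => /eqP ->.
have b'D : lrefl D (sr i) b \in Delta D by rewrite lrefl_root ?srD.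
have b'j0 : cd j0 (lrefl D (sr i) b) = cd j0 b.
  by rewrite coord_lrefl ij0 mulr0 subr0.
have b'0 : nonneg_coords D (lrefl D (sr i) b).
  by apply: (@root_nonneg _ j0) => //; rewrite b'j0; exact: noti.
have hb' : height (lrefl D (sr i) b) < N%:R.
  by rewrite height_lrefl -/c; move: hb; rewrite -natr1; lra.
have [] := IHN _ _ b'D b'0 hb' orth.
- move=> bK.
  have bK' k : K k -> cd k b = c * (k == i)%:R.
    by move=> /bK; rewrite coord_lrefl -/c => /eqP; rewrite subr_eq0 => /eqP.
  have : '(b, sr i) = cd i b * '(sr i, sr i).
    rewrite ip_coord (bigD1 i) //= big1 ?addr0 // => k ki.
    have [Kk|Kk] := boolP (K k); first by rewrite bK' // (negbTE ki) mulr0 mul0r.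
    by rewrite ipC orth // mulr0.
  have := bK' i Ki; rewrite eqxx mulr1 /c ip_coroot => bc.
  move=> bE; move: bc; rewrite bE mulrA mulfK ?gt_eqF ?root_gt0 ?srD //.
  lra.
- by move=> /(_ j0 Kj0); rewrite b'j0.
Qed.

End Coordinates.

(** * The highest root and the positive affine roots *)

Section HighestRoot.
Variables (R : realType) (n : nat) (D : rootData R n).
Local Notation V := 'rV[R]_n.
Local Notation "''(' x , y )" := (inner D x y : R) (format "''(' x ,  y )").
Local Notation sr i := ((simples D)`_(i : 'I_n)).

Lemma seq_argmax (T : eqType) (s : seq T) (P : T -> Prop) (f : T -> R) :
  (exists2 x, x \in s & P x) ->
  exists x, [/\ x \in s, P x & forall y, y \in s -> P y -> f y <= f x].
Proof.
elim: s => [|a s IHs] [x]; first by rewrite in_nil.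
rewrite in_cons => xs Px.
have [Ps|Ps] := pselect (exists2 x, x \in s & P x); last first.
  have {}xs : x = a.
    by case/orP: xs => [/eqP|xs] //; case: Ps; exists x.
  exists a; rewrite mem_head -xs; split=> // y; rewrite in_cons.
  by case/orP=> [/eqP->//|ys Py]; case: Ps; exists y.
have [z [zs Pz zmax]] := IHs Ps.
have [[Pa fa]|no] := pselect (P a /\ f z <= f a).
  exists a; rewrite mem_head; split=> // y; rewrite in_cons.
  case/orP=> [/eqP->//|ys Py]; exact: le_trans (zmax _ ys Py) fa.
exists z; rewrite in_cons zs orbT; split=> // y; rewrite in_cons.
case/orP=> [/eqP-> Pa|ys Py]; last exact: zmax.
by rewrite leNgt; apply/negP => /ltW fa; apply: no.
Qed.

(** Reflecting a root in a simple root that makes an obtuse angle with it raises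
    it. *)
Lemma lrefl_up (b : V) i : b \in Delta D -> '(sr i, b) < 0 ->
  nonneg_coords D (lrefl D (sr i) b - b) /\ height D b < height D (lrefl D (sr i) b).
Proof.
move=> bD bi; have : '(coroot D (sr i), - b) > 0.
  by rewrite ip_coroot_gt0 ?srD // ipNr oppr_gt0.
rewrite ipNr => c0; split; last by rewrite height_lrefl; lra.
by rewrite lreflE addrC addKr -scaleNr nonnegZ ?nonneg_simple // ltW.
Qed.

(** Root of maximal height among the roots above a given one: it pairs
    nonnegatively with the simple roots, since a reflection would raise it. *)
Lemma maximal_above (b : V) : b \in Delta D -> exists a,
  [/\ a \in Delta D, nonneg_coords D (a - b), forall i, 0 <= '(sr i, a) &
      forall c, c \in Delta D -> nonneg_coords D (c - a) -> c = a].
Proof.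
move=> bD; have bP : exists2 x, x \in (Delta D : seq V) & nonneg_coords D (x - b).
  by exists b; rewrite ?subrr ?nonneg0.
have [a [aD ab amax]] := seq_argmax (height D) bP.
exists a; split=> // [i|c cD ca]; last first.
  apply/eqP; rewrite -subr_eq0; apply/eqP/(height_eq0 ca).
  by rewrite heightB subr_le0 amax // (nonneg_trans ab).
rewrite leNgt; apply/negP => /(lrefl_up aD)[up]; apply/negP; rewrite -leNgt.
by rewrite amax ?(nonneg_trans ab) //; apply: lrefl_root => //; exact: srD.
Qed.

Lemma dominant_nonneg (a : V) : a \in Delta D -> (forall i, 0 <= '(sr i, a)) ->
  nonneg_coords D a.
Proof.
move=> aD a0; have [//|aN] := orP (root_sign aD).
have := ip_gt0 D (root_neq0 aD); rewrite ltNge ip_coord sumr_le0 // => i _.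
by rewrite mulr_le0_ge0 //; have /nonnegP/(_ i) := aN; rewrite cdN oppr_ge0.
Qed.

(** The support of a dominant root is the whole base. *)
Lemma dominant_support (a : V) i : a \in Delta D ->
  (forall i, 0 <= '(sr i, a)) -> 0 < cd D i a.
Proof.
move=> aD adom; have /nonnegP a0 := dominant_nonneg aD adom.
(* the complement of the support; it is orthogonal to the support because the
   simple roots make obtuse angles *)
pose K : pred 'I_n := [pred j | cd D j a == 0].
have orth k j : K k -> ~~ K j -> '(sr k, sr j) = 0.
  move=> /eqP ak aj.
  have le0 l : cd D l a * '(sr l, sr k) <= 0.
    have [<-|kl] := eqVneq k l; first by rewrite ak mul0r.
    by rewrite mulr_ge0_le0 ?simples_obtuse // eq_sym.
  have s0 : \sum_l cd D l a * '(sr l, sr k) = 0.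
    by apply: le_anti; rewrite sumr_le0 //= -ip_coord ipC adom.
  have : cd D j a * '(sr j, sr k) = 0.
    apply: le_anti; rewrite le0 /=; move: s0; rewrite (bigD1 j) //= => s0.
    have : \sum_(l < n | l != j) cd D l a * '(sr l, sr k) <= 0 by rewrite sumr_le0.
    lra.
  rewrite ipC => /eqP; rewrite mulf_eq0 => /orP[|/eqP//].
  by rewrite (negbTE (aj : cd D j a != 0)).
pose S := [fset b in Delta D | [forall j, ~~ K j ==> (cd D j b == 0)]]%fset.
have SP b : b \in S -> b \in Delta D /\ forall j, ~~ K j -> cd D j b = 0.
  rewrite !inE /= => /andP[-> /forallP Kb]; split=> // j Kj.
  by have /implyP/(_ Kj)/eqP := Kb j.
have SI b : b \in Delta D -> (forall j, ~~ K j -> cd D j b = 0) -> b \in S.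
  move=> bD bK; rewrite !inE /= bD; apply/forallP => j; apply/implyP => Kj.
  by rewrite bK.
have bsplit b : b \in Delta D ->
    (forall i, K i -> cd D i b = 0) \/ (forall i, ~~ K i -> cd D i b = 0).
  move=> bD; case/orP: (root_sign bD) => b0; first exact: support_split.
  have [] := support_split (oppr_root bD) b0 orth => bK; [left|right] => j /bK/eqP;
    by rewrite cdN oppr_eq0 => /eqP.
(* the roots supported in [K] and the others are orthogonal to each other *)
have [||S0|SD] := @Delta_irreducible _ _ D S.
- by apply/fsubsetP => b /SP[].
- move=> b c /SP[bD bK]; rewrite in_fsetD => /andP[cS cD].
  have [cK|cK] := bsplit c cD; last by rewrite SI in cS.
  rewrite ip_coord big1 // => k _.
  have [Kk|Kk] := boolP (K k); last by rewrite bK ?mul0r.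
  rewrite ipC ip_coord big1 ?mulr0 // => l _.
  have [Kl|Kl] := boolP (K l); first by rewrite cK ?mul0r.
  by rewrite ipC orth ?mulr0.
- rewrite lt_def a0 andbT; apply/negP => Ki.
  have : sr i \in S; last by rewrite S0 inE.
  apply: SI (srD _ _) _ => j Kj; rewrite coord_simple.
  by case: eqVneq => // ji; move: Kj; rewrite ji /K /= Ki.
- have aS : a \in S by rewrite SD.
  have [_ aK] := SP _ aS.
  case/eqP: (root_neq0 aD); apply: (@coord_eq0 _ _ D) => j.
  by have [/eqP|/aK] := boolP (K j).
Qed.

Lemma cart_ge1 a b : a \in Delta D -> b \in Delta D -> 0 < '(a, b) ->
  1 <= '(coroot D a, b).
Proof.
move=> aD bD; rewrite -ip_coroot_gt0 // -(floorK (cart_int aD bD)).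
by rewrite ltr0z ler1z; lia.
Qed.

(** Two roots at an acute angle are equal or differ by a root. *)
Lemma acute_roots a b : a \in Delta D -> b \in Delta D -> 0 < '(a, b) ->
  a = b \/ a - b \in Delta D.
Proof.
move=> aD bD ab; have ba : 0 < '(b, a) by rewrite ipC.
have [a1|a1] := eqVneq '(coroot D a, b) 1.
  right; rewrite -opprB; apply: oppr_root.
  by rewrite -[in X in _ - X](scale1r a) -a1 -lreflE; exact: lrefl_root.
have [b1|b1] := eqVneq '(coroot D b, a) 1.
  by right; rewrite -[in X in _ - X](scale1r b) -b1 -lreflE; exact: lrefl_root.
have ge2 x y : x \in Delta D -> y \in Delta D -> 0 < '(x, y) ->
    '(coroot D x, y) != 1 -> '(x, x) <= '(x, y).
  move=> xD yD xy; rewrite ip_coroot => c1.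
  have := cart_ge1 xD yD xy; rewrite ip_coroot le_eqVlt eq_sym (negbTE c1) /=.
  rewrite -ip_coroot -(floorK (cart_int xD yD)) ltr1z => c2.
  have : 2%:~R <= '(coroot D x, y).
    rewrite -(floorK (cart_int xD yD)) ler_int.
    by move: c2; case: (Num.floor _) => -[|[|]].
  by rewrite ip_coroot ler_pdivlMr ?root_gt0 // ler_pM2l ?ltr0n // (ipC D y).
left; apply/eqP; rewrite -subr_eq0; apply/eqP/(@ip_eq0 _ _ D)/le_anti.
rewrite ip_ge0 andbT ipBl !ipBr (ipC D b a).
have := ge2 a b aD bD ab a1; have := ge2 b a bD aD ba b1; rewrite (ipC D b a).
by move: (inner D a b : R) (inner D a a : R) (inner D b b : R) => x y z; lra.
Qed.

(** The maximal root above any given root has full support, so any two such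
    roots make an acute angle, and their difference, if it were a root, would
    make them comparable. *)
Lemma highest_root_exists : exists t, highest_root D t.
Proof.
have [b0 b0D] : exists b, b \in Delta D by apply/fset0Pn; exact: Delta_nonempty.
have [t [tD _ tdom tmax]] := maximal_above b0D; exists t.
rewrite /highest_root tD; apply/allP => b bD.
have [c [cD cb cdom cmax]] := maximal_above bD; suff -> : t = c by [].
have tc : 0 < '(t, c).
  have [i _ ci] := ip_pos_simple (dominant_nonneg cD cdom) (root_neq0 cD).
  rewrite ip_coord (bigD1 i) //= ltr_pwDl //.
    by rewrite mulr_gt0 ?dominant_support.
  by rewrite sumr_ge0 // => j _; rewrite mulr_ge0 // ltW // dominant_support.
have [//|tcD] := acute_roots tD cD tc.
case/orP: (root_sign tcD) => [tc0|]; first exact: cmax.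
by rewrite opprB => /(tmax _ cD).
Qed.

Lemma highest_nonneg t : highest_root D t -> nonneg_coords D t.
Proof.
move=> /andP[tD /allP/(_ _ (oppr_root tD))]; rewrite opprK => /nonnegP t0.
by apply/nonnegP => i; have := t0 i; rewrite cdD; lra.
Qed.

(** Positivity of an affine root read off its coordinates in the affine base:
    that of [(- t, 1)] is the second component, the others are those of the
    vector below. *)
Lemma aff_posE t r : highest_root D t -> r.1 \in Delta D ->
  aff_pos_root D r = (0 <= r.2) && nonneg_coords D (r.1 + r.2%:~R *: t).
Proof.
move=> th rD; have tpos := highest_nonneg th; case/andP: th => tD /allP tmax.
rewrite /aff_pos_root /pos_root rD /=.
case: (ltgtP 0 r.2) => [r0|r0|<-] /=.
- apply/esym; have := tmax _ (oppr_root rD); rewrite opprK addrC => rt.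
  have -> : r.1 + r.2%:~R *: t = (r.1 + t) + (r.2 - 1)%:~R *: t.
    by rewrite -addrA -{2}(scale1r t) -scalerDl rmorphB addrC subrKC addrC.
  by rewrite nonnegD // nonnegZ // ler0z; lia.
- by rewrite andbF.
- by rewrite scale0r addr0 andbT.
Qed.

Lemma aff_pos_rootD r : aff_pos_root D r -> r.1 \in Delta D.
Proof. by case/orP=> [/andP[]|/andP[/andP[]]]. Qed.

Lemma aff_posN r : r.1 \in Delta D -> ~~ aff_pos_root D r ->
  aff_pos_root D (oppr_aff r).
Proof.
move=> rD; rewrite /aff_pos_root /= /pos_root rD oppr_root //= oppr_eq0 oppr_gt0.
case: (ltgtP 0 r.2) => //= _; rewrite andbT.
by case/orP: (root_sign rD) => ->.
Qed.

Lemma aff_simpleD q : aff_simple_root D q -> q.1 \in Delta D.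
Proof.
case/orP=> /andP[]; first by move=> /srP[i ->] _; exact: srD.
by move=> /andP[/oppr_root]; rewrite opprK.
Qed.

Lemma aff_simple_pos q : aff_simple_root D q -> aff_pos_root D q.
Proof.
move=> qs; have qD := aff_simpleD qs; rewrite /aff_pos_root qD /=.
case/orP: qs => /andP[]; last by move=> _ /eqP ->.
by move=> /srP[i ->] /eqP ->; rewrite /pos_root srD nonneg_simple eqxx orbT.
Qed.

(** A simple reflection permutes the positive affine roots other than its own:
    it changes only one coordinate in the affine base. *)
Lemma act_simple_pos q r : aff_simple_root D q -> aff_pos_root D r -> r != q ->
  aff_pos_root D (act D q r).
Proof.
move=> qs rpos; have qD := aff_simpleD qs; have rD := aff_pos_rootD rpos.
have sD := act_root qD rD; apply: contraNT => /(aff_posN sD) sneg.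
have act2 : (act D q r).2%:~R = r.2%:~R - q.2%:~R * '(coroot D q.1, r.1) :> R.
  by rewrite rmorphB rmorphM /= (floorK (cart_int qD rD)).
have [t0 t0h] := highest_root_exists.
case/orP: qs => /andP[].
- move=> /srP[i qi] /eqP q0.
  have act2' : (act D q r).2 = r.2 by rewrite /= q0 mul0r subr0.
  have o2 : (oppr_aff (act D q r)).2 = - r.2 by rewrite -act2'.
  have := sneg; rewrite (aff_posE t0h) ?oppr_root // o2 oppr_ge0.
  move=> /andP[r0' _].
  have r0 : r.2 = 0.
    have := rpos; rewrite (aff_posE t0h) // => /andP[r0 _].
    by apply: le_anti; rewrite r0' r0.
  have ra : nonneg_coords D r.1.
    by have := rpos; rewrite (aff_posE t0h) // r0 scale0r addr0 => /andP[].
  have sa : nonneg_coords D (- lrefl D (sr i) r.1).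
    have := sneg; rewrite (aff_posE t0h) ?oppr_root // o2 r0 oppr0 scale0r.
    by rewrite addr0 /= qi.
  have r1 : r.1 = sr i.
    apply: root_multiple => // j ji; have /nonnegP/(_ j) := ra.
    have /nonnegP/(_ j) := sa; rewrite cdN coord_lrefl (negbTE ji) mulr0 subr0.
    lra.
  by apply/eqP/injective_projections; rewrite ?qi ?q0.
- move=> th /eqP q1; move: th; move Et: (- q.1) => t th.
  have qt : q.1 = - t by rewrite -Et opprK.
  have rt : nonneg_coords D (r.1 + r.2%:~R *: t) /\ 0 <= r.2.
    by have := rpos; rewrite (aff_posE th) // => /andP[].
  have := sneg; rewrite (aff_posE th) ?oppr_root // => /andP[_].
  have -> : (oppr_aff (act D q r)).2%:~R = - (act D q r).2%:~R :> R.
    by rewrite rmorphN.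
  rewrite act2 q1 mul1r scaleNr -opprD [(act D q r).1]lreflE.
  have -> : r.1 - '(coroot D q.1, r.1) *: q.1 +
      (r.2%:~R - '(coroot D q.1, r.1)) *: t = r.1 + r.2%:~R *: t.
    move: (inner D (coroot D q.1) r.1 : R) => c; rewrite qt.
    by apply/rowP => j; rewrite !mxE; ring.
  move=> /(nonneg_anti rt.1)/eqP; rewrite addr_eq0 -scaleNr => /eqP r1.
  have tD : t \in Delta D by case/andP: th.
  have r1D : - r.2%:~R *: t \in Delta D by rewrite -r1.
  have [r2|r2] := Delta_reduced tD r1D.
    have : (0 : R) <= r.2%:~R by rewrite ler0z; case: rt.
    by rewrite -oppr_le0 r2 ler10.
  have r21 : r.2 = 1.
    by apply/eqP; rewrite -(eqr_int R) -eqr_opp r2.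
  apply/eqP/injective_projections; last by rewrite q1.
  by rewrite r1 r2 scaleN1r.
Qed.

(** A positive affine root is a nonnegative combination of simple ones, so its
    gradient makes an acute angle with that of one of them. *)
Lemma aff_pos_descent r : aff_pos_root D r ->
  exists2 q, aff_simple_root D q & 0 < '(q.1, r.1).
Proof.
move=> rpos; have rD := aff_pos_rootD rpos.
have [t th] := highest_root_exists.
apply: contrapT => no.
have simple_le0 q : aff_simple_root D q -> '(q.1, r.1) <= 0.
  by move=> qs; rewrite leNgt; apply/negP => q0; apply: no; exists q.
have := ip_gt0 D (root_neq0 rD).
have -> : '(r.1, r.1) = '(r.1 + r.2%:~R *: t, r.1) + r.2%:~R * '(- t, r.1).
  by rewrite ipDl ipZl ipNl mulrN addrK.
have := rpos; rewrite (aff_posE th) // => /andP[r0 /nonnegP rt].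
rewrite ltNge -oppr_ge0 opprD addr_ge0 // oppr_ge0.
  rewrite ip_coord sumr_le0 // => i _; rewrite mulr_ge0_le0 //.
  by apply: (simple_le0 (sr i, 0)); rewrite /aff_simple_root /= sr_mem eqxx.
rewrite mulr_ge0_le0 ?ler0z //.
by apply: (simple_le0 (- t, 1)); rewrite /aff_simple_root /= opprK th eqxx orbT.
Qed.

End HighestRoot.

(** * Words and lengths in the affine Weyl group *)

Section Words.
Variables (R : realType) (n : nat) (D : rootData R n).
Local Notation V := 'rV[R]_n.
Local Notation "''(' x , y )" := (inner D x y : R) (format "''(' x ,  y )").

(** Points of the fundamental alcove, described by the finite positive
    roots. *)
Definition base_point (p : V) : Prop :=
  forall a, pos_root D a -> 0 < '(p, a) < 1.

(** [hyperplanes_compl D] is the set of generic points: no affine root vanishes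
    there. *)
Lemma generic_rval l r : hyperplanes_compl D l -> r.1 \in Delta D ->
  rval D r l != 0.
Proof. by move=> gl rD; rewrite /rval addr_eq0 gl. Qed.

Lemma base_aff_pos p r : base_point p -> aff_pos_root D r -> 0 < rval D r p.
Proof.
move=> bp; rewrite /rval => /orP[/andP[rD r2]|/andP[ra /eqP ->]]; last first.
  by rewrite addr0; case/andP: (bp _ ra).
have r1 : (1 : R) <= r.2%:~R by rewrite ler1z; move: r2; case: r.2 => -[].
case/orP: (root_sign rD) => r0.
  have : pos_root D r.1 by rewrite /pos_root rD.
  by move=> /bp/andP[]; lra.
have : pos_root D (- r.1) by rewrite /pos_root oppr_root.
by move=> /bp; rewrite ipNr => /andP[]; lra.
Qed.

(** The positive affine roots are those that are positive at a base point. *)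
Lemma aff_pos_base p r : base_point p -> r.1 \in Delta D ->
  aff_pos_root D r = (0 < rval D r p).
Proof.
move=> bp rD; apply/idP/idP; first exact: base_aff_pos.
apply: contraTT => /(aff_posN rD)/(base_aff_pos bp).
by rewrite rvalN oppr_gt0 => /ltW; rewrite -leNgt.
Qed.

Lemma base_generic p : base_point p -> hyperplanes_compl D p.
Proof.
move=> bp a k aD; have := @aff_pos_base p (a, k) bp aD.
have := aff_pos_base bp (oppr_root aD : (oppr_aff (a, k)).1 \in Delta D).
rewrite rvalN oppr_gt0 => posN pos; apply/eqP => ak.
have k0 : rval D (a, k) p = 0 by rewrite /rval /= ak addNr.
have := @aff_posN _ _ D (a, k) aD; rewrite pos posN k0 ltxx.
by move=> /(_ isT).
Qed.

(** Finitely many positive numbers have a positive lower bound. *)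
Lemma seq_pos_lb (T : eqType) (s : seq T) (f : T -> R) :
  (forall x, x \in s -> 0 < f x) ->
  exists2 e, 0 < e & forall x, x \in s -> e <= f x.
Proof.
elim: s => [|a s IHs] fpos; first by exists 1.
have [|e e0 ele] := IHs; first by move=> x xs; rewrite fpos // in_cons xs orbT.
exists (Num.min (f a) e); first by rewrite lt_min e0 fpos // mem_head.
move=> x; rewrite in_cons ge_min => /orP[/eqP->|/ele->]; rewrite ?lexx ?orbT //.
Qed.

(** The values of the affine roots at a generic point are bounded away
    from [0]. *)
Lemma rval_lb l : hyperplanes_compl D l -> exists2 e, 0 < e &
  forall r, r.1 \in Delta D -> e <= `|rval D r l|.
Proof.
move=> gl.
pose f a := Num.min ('(l, a) - (Num.floor '(l, a))%:~R)
                    ((Num.floor '(l, a) + 1)%:~R - '(l, a)).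
have [a aD|e e0 ele] := @seq_pos_lb _ (Delta D) f.
  rewrite /f lt_min !subr_gt0 lt_neqAle floor_le andbT floorD1_gt andbT.
  by have := gl a (- Num.floor '(l, a)) aD; rewrite rmorphN opprK eq_sym.
exists e => // r rD; apply: le_trans (ele _ rD) _; rewrite /f /rval ge_min.
apply/orP; have [rk|rk] := leP (- Num.floor '(l, r.1)) r.2; [left|right].
  rewrite -(ler_int R) rmorphN in rk; apply: le_trans _ (ler_norm _); lra.
rewrite -lezD1 -(ler_int R) rmorphN !rmorphD /= in rk.
rewrite rmorphD /= ler_normr; apply/orP; right; lra.
Qed.

(** The action of a word of affine reflections on affine roots. *)
Definition wact (ws : seq (V * int)) (r : V * int) : V * int :=
  foldr (act D) r ws.

(** Words in the reflections of all affine roots, of either sign. *)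
Definition rootword (ws : seq (V * int)) : bool :=
  all (fun r => r.1 \in Delta D) ws.

Lemma simple_rootword ws : all (aff_simple_root D) ws -> rootword ws.
Proof. by apply: sub_all => r; exact: aff_simpleD. Qed.

Lemma pos_rootword ws : all (aff_pos_root D) ws -> rootword ws.
Proof. by apply: sub_all => r; exact: aff_pos_rootD. Qed.

Lemma wact_root ws r : rootword ws -> r.1 \in Delta D ->
  (wact ws r).1 \in Delta D.
Proof.
elim: ws => //= q ws IHws /andP[qD wsD] rD; apply: act_root => //; exact: IHws.
Qed.

Lemma rval_wact ws r l : rootword ws -> r.1 \in Delta D ->
  rval D (wact ws r) (word_prod D ws l) = rval D r l.
Proof.
elim: ws => //= q ws IHws /andP[qD wsD] rD.
by rewrite rval_act ?wact_root // aff_reflK // IHws.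
Qed.

Lemma aff_refl_wact ws r l : rootword ws -> r.1 \in Delta D ->
  aff_refl D (wact ws r) (word_prod D ws l) = word_prod D ws (aff_refl D r l).
Proof.
elim: ws => //= q ws IHws /andP[qD wsD] rD.
by rewrite aff_refl_act ?wact_root // aff_reflK // IHws.
Qed.

Lemma word_prod_cat ws vs :
  word_prod D (ws ++ vs) = word_prod D ws \o word_prod D vs.
Proof. by elim: ws => //= q ws ->. Qed.

Lemma word_prodK ws : rootword ws ->
  cancel (word_prod D (rev ws)) (word_prod D ws).
Proof.
elim: ws => //= q ws IHws /andP[qD wsD] l.
by rewrite rev_cons -cats1 word_prod_cat /= IHws // aff_reflK.
Qed.

Lemma word_prodVK ws : rootword ws ->
  cancel (word_prod D ws) (word_prod D (rev ws)).
Proof.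
move=> wsD; rewrite -{1}(revK ws); apply: word_prodK.
by rewrite /rootword all_rev.
Qed.

Lemma aff_reflK_root r : r.1 \in Delta D -> aff_refl D r \o aff_refl D r = id.
Proof.
by move=> rD; apply/funext => l /=; rewrite aff_reflK.
Qed.

(** Every reflection is a product of simple reflections: conjugating by a
    simple reflection lowers the value of the affine root at a base point. *)
Lemma refl_simple_word p r : base_point p -> aff_pos_root D r ->
  exists2 ws, all (aff_simple_root D) ws & word_prod D ws = aff_refl D r.
Proof.
move=> bp rpos; have [e e0 elb] := rval_lb (base_generic bp).
have /ltW/archi_boundP : 0 < rval D r p / e by rewrite divr_gt0 ?base_aff_pos.
move: (Num.bound _) => N; rewrite ltr_pdivrMr //.
elim: N r rpos => [|N IHN] r rpos rN.
  by move: rN; rewrite mul0r ltNge ltW // base_aff_pos.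
have [q qs qr] := aff_pos_descent rpos.
have [->|rq] := eqVneq r q; first by exists [:: q]; rewrite //= qs.
have qD := aff_simpleD qs; have rD := aff_pos_rootD rpos.
have [|ws wss wsE] := IHN _ (act_simple_pos qs rpos rq).
  rewrite rval_act // aff_reflE /rval ipBl ipZl.
  have := cart_ge1 qD rD qr; have := base_aff_pos bp (aff_simple_pos qs).
  have := elb _ qD; move: rN; rewrite /rval -natr1 => rN + q0.
  rewrite gtr0_norm // => eq c1.
  have : e <= ('(p, q.1) + q.2%:~R) * '(coroot D q.1, r.1).
    by rewrite (le_trans eq) // ler_peMr // ltW.
  lra.
exists (q :: ws ++ [:: q]); first by rewrite /= all_cat wss /= qs.
rewrite /= word_prod_cat wsE; apply/funext => l /=.
by rewrite aff_refl_act // !aff_reflK.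
Qed.

Lemma word_simple_word p ws : base_point p -> rootword ws ->
  exists2 vs, all (aff_simple_root D) vs & word_prod D vs = word_prod D ws.
Proof.
move=> bp; elim: ws => [|r ws IHws] /=; first by exists [::].
move=> /andP[rD /IHws[vs vss <-]].
have [us uss usE] : exists2 us, all (aff_simple_root D) us &
    word_prod D us = aff_refl D r.
  have [rpos|/(aff_posN rD) rneg] := boolP (aff_pos_root D r).
    exact: refl_simple_word bp rpos.
  by rewrite -aff_reflN; exact: refl_simple_word bp rneg.
by exists (us ++ vs); rewrite ?all_cat ?uss // word_prod_cat usE.
Qed.

Lemma aff_weyl_word ws : rootword ws -> aff_weyl D (word_prod D ws).
Proof.
elim: ws => [|r ws IHws] /=; first by exists [::].
move=> /andP[rD /IHws[vs vsp ->]].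
have [rpos|/(aff_posN rD) rneg] := boolP (aff_pos_root D r).
  by exists (r :: vs) => //=; rewrite rpos.
by exists (oppr_aff r :: vs) => /=; rewrite ?rneg // aff_reflN.
Qed.

Lemma aff_weylP w : aff_weyl D w ->
  exists2 ws, rootword ws & w = word_prod D ws.
Proof. by case=> ws /pos_rootword wsD ->; exists ws. Qed.

Lemma aff_weyl_id : aff_weyl D id.
Proof. exact: (@aff_weyl_word [::]). Qed.

Lemma aff_weyl_comp v w : aff_weyl D v -> aff_weyl D w -> aff_weyl D (v \o w).
Proof.
move=> /aff_weylP[vs vsD ->] /aff_weylP[ws wsD ->].
rewrite -word_prod_cat; apply: aff_weyl_word.
by rewrite /rootword all_cat; apply/andP.
Qed.

Lemma aff_weyl_refl r : r.1 \in Delta D -> aff_weyl D (aff_refl D r).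
Proof. by move=> rD; apply: (@aff_weyl_word [:: r]); rewrite /= rD. Qed.

Lemma aff_weyl_inv w : aff_weyl D w ->
  exists v, [/\ aff_weyl D v, cancel w v & cancel v w].
Proof.
move=> /aff_weylP[ws wsD ->]; exists (word_prod D (rev ws)); split.
- by apply: aff_weyl_word; rewrite /rootword all_rev.
- exact: word_prodVK.
- exact: word_prodK.
Qed.

Section Length.
Variable p : V.
Hypothesis bp : base_point p.

Lemma aff_lengthP w : aff_weyl D w ->
  has_simple_word D w (aff_length D w) /\
  forall j, has_simple_word D w j -> (aff_length D w <= j)%N.
Proof.
move=> /aff_weylP[ws wsD wE]; have [vs vss vE] := word_simple_word bp wsD.
have ex : exists k, `[< has_simple_word D w k >].
  by exists (size vs); apply/asboolP; exists vs; rewrite wE.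
rewrite /aff_length; apply: (@xgetPex _ 0%N [set k | has_simple_word D w k /\
  forall j, has_simple_word D w j -> (k <= j)%N]).
case: (ex_minnP ex) => k /asboolP wk kmin; exists k; split=> // j wj.
by apply: kmin; apply/asboolP.
Qed.

(** The exchange property: if a simple word makes [r] negative then some letter
    of it does, and deleting this letter multiplies the product by the
    reflection of [r]. *)
Lemma exchange ws r : all (aff_simple_root D) ws -> aff_pos_root D r ->
  ~~ aff_pos_root D (wact ws r) ->
  exists2 k, (k < size ws)%N & has_simple_word D (word_prod D ws \o aff_refl D r) k.
Proof.
elim: ws => [|q ws IHws] /=; first by move=> _ ->.
move=> /andP[qs wss] rpos neg; have rD := aff_pos_rootD rpos.
have qD := aff_simpleD qs; have wsD := simple_rootword wss.
have [wrpos|wrneg] := boolP (aff_pos_root D (wact ws r)); last first.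
  have [k kws [vs [szvs vss vsE]]] := IHws wss rpos wrneg.
  exists k.+1; first exact: kws.
  by exists (q :: vs); rewrite /= szvs qs vss -vsE.
exists (size ws); first exact: ltnSn.
exists ws; split=> //; apply/funext => l /=.
have [wrq|/(act_simple_pos qs wrpos)] := eqVneq (wact ws r) q.
  by rewrite -aff_refl_wact // wrq aff_reflK.
by rewrite (negbTE neg).
Qed.

(** Multiplication on the right by [aff_refl r] lengthens [y] exactly when the
    root [r] takes a positive value at the preimage of the base point. *)
Lemma aff_length_refl y r u : aff_weyl D y -> aff_pos_root D r -> y u = p ->
  (aff_length D y < aff_length D (y \o aff_refl D r))%N = (0 < rval D r u).
Proof.
move=> yW rpos yu; have rD := aff_pos_rootD rpos.
have short z v : aff_weyl D z -> z v = p -> rval D r v < 0 ->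
    (aff_length D (z \o aff_refl D r) < aff_length D z)%N.
  move=> zW zv rv; have [[ws [szws wss zE]] _] := aff_lengthP zW.
  have wsD := simple_rootword wss.
  have [|k kws kz] := exchange wss rpos.
    rewrite (aff_pos_base bp) ?wact_root // -leNgt.
    by rewrite -zv zE rval_wact // ltW.
  apply: leq_ltn_trans _ (_ : (k < _)%N); last by rewrite -szws.
  by apply: (aff_lengthP _).2; rewrite ?zE //; apply: aff_weyl_comp;
    [exact: aff_weyl_word | exact: aff_weyl_refl].
have yrW : aff_weyl D (y \o aff_refl D r).
  by apply: aff_weyl_comp; last exact: aff_weyl_refl.
have ru0 : rval D r u != 0.
  move/aff_weylP: yW yu => [ws wsD ->] wsu.
  rewrite -(rval_wact u wsD rD) wsu generic_rval ?wact_root //.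
  exact: base_generic.
have [ru|ru] := ltP 0 (rval D r u).
  have := short _ (aff_refl D r u) yrW.
  rewrite /= aff_reflK // rval_refl // oppr_lt0.
  move=> /(_ yu ru); congr (_ < _)%N; congr (aff_length D _).
  by rewrite -compA aff_reflK_root.
apply/negbTE; rewrite -leqNgt ltnW //; apply: (short _ u) => //.
by rewrite lt_neqAle ru0.
Qed.

(** An element of the affine Weyl group keeping all positive affine roots
    positive is trivial. *)
Lemma aff_weyl_trivial w u : aff_weyl D w -> w u = p ->
  (forall r, aff_pos_root D r -> 0 < rval D r u) -> w = id.
Proof.
move=> wW wu upos; have [[ws [szws wss wE]] wmin] := aff_lengthP wW.
case/lastP: ws szws wss wE => [//|ws q] szws; rewrite all_rcons => /andP[qs wss] wE.
have qD := aff_simpleD qs.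
have wqE : w \o aff_refl D q = word_prod D ws.
  rewrite wE -cats1 word_prod_cat /= -compA; congr (_ \o _).
  exact: aff_reflK_root.
have := aff_length_refl wW (aff_simple_pos qs) wu.
rewrite upos ?aff_simple_pos // wqE -szws size_rcons.
have wsW : aff_weyl D (word_prod D ws).
  by apply: aff_weyl_word; exact: simple_rootword.
have : (aff_length D (word_prod D ws) <= size ws)%N.
  by apply: (aff_lengthP wsW).2; exists ws.
by move=> le_ws; rewrite ltnNge leqW.
Qed.

End Length.

End Words.

(** * Alcoves *)

Section Alcoves.
Variables (R : realType) (n : nat) (D : rootData R n).
Local Notation V := 'rV[R]_n.
Local Notation "''(' x , y )" := (inner D x y : R) (format "''(' x ,  y )").

(** The points on the same side as [l] of every affine root hyperplane; for
    generic [l] this is the alcove of [l]. *)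
Definition cell (l : V) : set V :=
  [set x | forall r, r.1 \in Delta D -> 0 < rval D r x * rval D r l].

Lemma genericP l : hyperplanes_compl D l <->
  forall r, r.1 \in Delta D -> rval D r l != 0.
Proof.
split=> [gl r|gl a k aD]; first exact: generic_rval.
by have := gl (a, k) aD; rewrite /rval addr_eq0.
Qed.

Lemma cell_refl l : hyperplanes_compl D l -> cell l l.
Proof. by move=> gl r rD; rewrite -expr2 exprn_even_gt0 // generic_rval. Qed.

Lemma cell_sym l x : cell l x -> cell x l.
Proof. by move=> lx r rD; rewrite mulrC lx. Qed.

Lemma cell_generic l x : cell l x -> hyperplanes_compl D x.
Proof.
move=> lx; apply/genericP => r rD; apply: contraTneq (lx r rD) => ->.
by rewrite mul0r ltxx.
Qed.

Lemma pos_mul_trans (x y z : R) : 0 < x * y -> 0 < y * z -> 0 < x * z.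
Proof.
move=> xy yz; have y0 : y != 0 by apply: contraTneq xy => ->; rewrite mulr0 ltxx.
have : 0 < (x * y) * (y * z) by rewrite mulr_gt0.
rewrite (_ : _ * _ = (x * z) * y ^+ 2); last by ring.
by rewrite pmulr_lgt0 // exprn_even_gt0.
Qed.

Lemma cell_eq l x : cell l x -> cell x = cell l.
Proof.
move=> lx; apply/seteqP; split=> y xy r rD.
  exact: pos_mul_trans (xy r rD) (lx r rD).
exact: pos_mul_trans (xy r rD) (cell_sym lx rD).
Qed.

Lemma generic_refl q l : q.1 \in Delta D -> hyperplanes_compl D l ->
  hyperplanes_compl D (aff_refl D q l).
Proof.
move=> qD gl; apply/genericP => r rD.
by rewrite -rval_act // generic_rval // act_root.
Qed.

Lemma cell_refl_image q l : q.1 \in Delta D ->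
  aff_refl D q @` cell l = cell (aff_refl D q l).
Proof.
move=> qD.
have sub m x : cell m x -> cell (aff_refl D q m) (aff_refl D q x).
  by move=> mx r rD; rewrite -!rval_act // mx // act_root.
apply/seteqP; split=> [_ [x lx <-]|x sx]; first exact: sub.
by exists (aff_refl D q x); rewrite ?aff_reflK // -[l](aff_reflK qD); exact: sub.
Qed.

Lemma generic_weyl w l : aff_weyl D w -> hyperplanes_compl D l ->
  hyperplanes_compl D (w l).
Proof.
move=> /aff_weylP[ws wsD ->] gl; elim: ws wsD => //= q ws IHws /andP[qD wsD].
exact: generic_refl (IHws wsD).
Qed.

Lemma cell_weyl_image w l : aff_weyl D w -> w @` cell l = cell (w l).
Proof.
move=> /aff_weylP[ws wsD ->]; elim: ws wsD => /= [|q ws IHws].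
  by rewrite image_id.
by move=> /andP[qD wsD]; rewrite -image_comp IHws // cell_refl_image.
Qed.

(** Translation by a coweight permutes the affine roots. *)
Lemma rval_translate mu r x : coweight D mu -> r.1 \in Delta D ->
  rval D r (x + mu) = rval D (r.1, r.2 + Num.floor '(mu, r.1)) x.
Proof.
move=> cmu rD; rewrite /rval ipDl /= rmorphD /= (floorK (cmu _ rD)); ring.
Qed.

Lemma coweightN mu : coweight D mu -> coweight D (- mu).
Proof. by move=> cmu a aD; rewrite ipNl rpredN cmu. Qed.

Lemma generic_translate mu l : coweight D mu -> hyperplanes_compl D l ->
  hyperplanes_compl D (l + mu).
Proof.
by move=> cmu gl; apply/genericP => r rD; rewrite rval_translate // generic_rval.
Qed.

Lemma cell_translate mu l : coweight D mu ->
  translate mu (cell l) = cell (l + mu).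
Proof.
move=> cmu.
have sub m x nu : coweight D nu -> cell m x -> cell (m + nu) (x + nu).
  by move=> cnu mx r rD; rewrite !rval_translate // mx.
apply/seteqP; split=> [_ [x lx <-]|x sx]; first exact: sub.
exists (x - mu); last by rewrite subrK.
by rewrite -(addrK mu l); apply: sub => //; exact: coweightN.
Qed.

Lemma rval_continuous r : continuous (rval D r : V -> R).
Proof.
have -> : (rval D r : V -> R) =
    (fun l => (\sum_i l 0 i * '(delta_mx 0 i, r.1)) + r.2%:~R).
  apply/funext => l; rewrite /rval {1}(row_sum_delta l) ip_suml.
  by congr (_ + _); apply: eq_bigr => i _; rewrite ipZl.
move=> l; apply: (@continuousD _ R^o V (fun m => \sum_i m 0 i * '(delta_mx 0 i, r.1))
  (cst r.2%:~R)); last exact: cst_continuous.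
apply: (@continuous_big R^o _ +%R 0 xpredT _ _ _
  (fun i (m : V) => m 0 i * '(delta_mx 0 i, r.1))).
  by move=> z; exact: add_continuous.
by move=> i _ m; apply: (@continuousM _ V (fun m => m 0 i) (cst _));
  [exact: coord_continuous | exact: cst_continuous].
Qed.

Lemma rval_segment r x y t :
  rval D r (x + t *: (y - x)) = (1 - t) * rval D r x + t * rval D r y.
Proof. by rewrite /rval ipDl ipZl ipBl; ring. Qed.

(** The connected components of the complement of the hyperplanes are the cells:
    a connected set cannot meet both sides of a hyperplane that it avoids, and a
    cell is convex. *)
Lemma component_cell l : hyperplanes_compl D l ->
  connected_component (hyperplanes_compl D) l = cell l.
Proof.
move=> gl; apply/seteqP; split=> x.
- move=> lx r rD.
  have gx := connected_component_sub lx.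
  have x0 := generic_rval gx rD; have l0 := generic_rval gl rD.
  rewrite lt_neqAle eq_sym mulf_neq0 //= leNgt; apply/negP => xl.
  pose C := connected_component (hyperplanes_compl D) l.
  have : connected (rval D r @` C).
    apply: connected_continuous_connected; first exact: component_connected.
    by apply: continuous_subspaceT; exact: rval_continuous.
  move=> /connected_intervalP itv.
  have Cx : (rval D r @` C) (rval D r x) by exists x.
  have Cl : (rval D r @` C) (rval D r l).
    by exists l => //; exact: connected_component_refl.
  have [c /connected_component_sub gc c0] : (rval D r @` C) 0.
    have [xneg|xpos] := ltP (rval D r x) 0.
      apply: itv Cx Cl _ _; rewrite ltW //=.
      by move: xl; rewrite nmulr_rlt0 // => /ltW.
    apply: itv Cl Cx _ _; rewrite xpos andbT.
    have x1 : 0 < rval D r x by rewrite lt_def x0.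
    by move: xl; rewrite pmulr_rlt0 // => /ltW.
  by have := generic_rval gc rD; rewrite c0 eqxx.
- move=> lx; pose f (t : R) : V := l + t *: (x - l).
  have fc : continuous f.
    move=> t; apply: cvgD; first exact: cvg_cst.
    exact: scalel_continuous.
  apply: (@connected_component_max _ _ (f @` `[0, 1]) l).
  + by exists 0; rewrite ?/f ?scale0r ?addr0 //= in_itv /= lexx ler01.
  + move=> z [t]; rewrite /= in_itv /= => /andP[t0 t1] <-; apply/genericP => r rD.
    rewrite rval_segment; have := lx r rD; have l0 := generic_rval gl rD.
    have l2 : 0 < rval D r l ^+ 2 by rewrite exprn_even_gt0.
    move=> xl.
    apply/eqP => eq0.
    have : 0 = (1 - t) * rval D r l ^+ 2 + t * (rval D r x * rval D r l).
      by rewrite -[LHS](mul0r (rval D r l)) -eq0; ring.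
    have [->|tn] := eqVneq t 1; first by rewrite subrr mul0r add0r mul1r; lra.
    have t1' : 0 < 1 - t by rewrite subr_gt0 lt_neqAle tn.
    have := mulr_gt0 t1' l2; have := mulr_ge0 t0 (ltW xl); lra.
  + apply: connected_continuous_connected; first exact: segment_connected.
    exact: continuous_subspaceT.
  + by exists 1; rewrite ?/f ?scale1r ?subrKC //= in_itv /= lexx ler01.
Qed.

Lemma alcoveP A : alcove D A <-> exists2 l, hyperplanes_compl D l & A = cell l.
Proof.
by split=> -[l gl ->]; exists l; rewrite ?component_cell.
Qed.

Lemma alcove_cell l : hyperplanes_compl D l -> alcove D (cell l).
Proof. by move=> gl; apply/alcoveP; exists l. Qed.

(** Dominance, tested on positive roots. *)
Definition dominant (l : V) : Prop := forall a, pos_root D a -> 0 < '(l, a).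

Lemma dominantP l : dominant l <-> dom_chamber D l.
Proof.
split=> [dl a as_|dl a /andP[aD /nonnegP a0]].
  rewrite ipC ip_coroot_gt0 ?(simples_Delta as_) // ipC; apply: dl.
  by have [i ->] := srP as_; rewrite /pos_root srD nonneg_simple.
have sl i : 0 < '((simples D)`_(i : 'I_n), l).
  by rewrite -ip_coroot_gt0 ?srD // ipC; apply: dl; exact: sr_mem.
have [i ai _] := ip_pos_simple (introT (nonnegP _ _) a0) (root_neq0 aD).
rewrite ipC ip_coord (bigD1 i) //= ltr_pwDl ?mulr_gt0 //.
by rewrite sumr_ge0 // => j _; rewrite mulr_ge0 // ltW.
Qed.

Lemma dominantD x y : dominant x -> dominant y -> dominant (x + y).
Proof. by move=> dx dy a apos; rewrite ipDl addr_gt0 // ?dx ?dy. Qed.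

Lemma cell_dominant l x : cell l x -> dominant l -> dominant x.
Proof.
move=> lx dl a apos; have := lx (a, 0); rewrite /rval /= !addr0.
by rewrite pmulr_lgt0 ?dl // => -> //; case/andP: apos.
Qed.

Lemma dom_alcove_cell l : hyperplanes_compl D l ->
  dom_alcove D (cell l) <-> dominant l.
Proof.
move=> gl; split=> [[_ sub]|dl]; first by apply/dominantP/sub/cell_refl.
split; first exact: alcove_cell.
by move=> x lx; apply/dominantP; exact: cell_dominant dl.
Qed.

Lemma base_dominant p : base_point D p -> dominant p.
Proof. by move=> bp a /bp/andP[]. Qed.

Lemma base_cell p q : base_point D p -> base_point D q -> cell p q.
Proof.
move=> bp bq r rD; have pr := aff_pos_base bp rD; have qr := aff_pos_base bq rD.
have := generic_rval (base_generic bp) rD; have := generic_rval (base_generic bq) rD.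
have [rp|rn] := boolP (aff_pos_root D r); first by rewrite mulr_gt0 // -?pr -?qr.
rewrite -mulrNN => q0 p0; rewrite mulr_gt0 // oppr_gt0 lt_neqAle ?q0 ?p0 /= leNgt.
  by rewrite -qr.
by rewrite -pr.
Qed.

Lemma cell_base p q : base_point D p -> cell p q -> base_point D q.
Proof.
move=> bp pq a apos; have aD : a \in Delta D by case/andP: apos.
have /andP[pa0 pa1] := bp a apos.
have := pq (a, 0) aD; rewrite /rval /= !addr0 pmulr_lgt0 // => -> /=.
have := pq (a, -1) aD; rewrite /rval /= rmorphN1 nmulr_lgt0 ?subr_lt0 //.
Qed.

Lemma base_scale p t : base_point D p -> 0 < t -> t <= 1 -> base_point D (t *: p).
Proof.
move=> bp t0 t1 a /bp/andP[a0 a1]; rewrite ipZl mulr_gt0 //=.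
by rewrite (le_lt_trans _ a1) // ler_piMl // ltW.
Qed.

(** The fundamental alcove is the cell of any base point: a dominant alcove with
    [0] in its closure lies where all positive roots have values below [1]. *)
Lemma fund_alcoveE p : base_point D p -> fund_alcove D = cell p.
Proof.
move=> bp; have gp := base_generic bp; apply: xget_unique.
  split; first exact/dom_alcove_cell/base_dominant.
  move=> B B0; have : (fun t : R => t *: p) @ 0^'+ --> (0 : V).
    rewrite -[X in _ --> X](scale0r p); apply: cvg_at_right_filter.
    exact: scalel_continuous.
  move=> /(_ _ B0) /= tB.
  near (0 : R)^'+ => t; exists (t *: p); split; last by near: t.
  apply: base_cell => //; apply: base_scale => //; near: t.
  exact: nbhs_right_le.
move=> _ [[/alcoveP[l gl ->]] sub cl0].
have dl : dominant l by apply/dominantP/sub/cell_refl.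
apply/esym/cell_eq/cell_sym/base_cell => // a apos.
have aD : a \in Delta D by case/andP: apos.
rewrite dl //= ltNge; apply/negP => la.
have U0 : nbhs (0 : V) (rval D (a, -1) @^-1` [set x | x < 0]).
  apply: rval_continuous; rewrite /rval /= ip0l add0r rmorphN1.
  by apply: open_nbhs_nbhs; split; [exact: open_lt | rewrite /= oppr_lt0].
have [x [lx /=]] := cl0 _ U0; rewrite ltNge => /negP; apply.
have := lx (a, -1) aD; have := generic_rval gl (aD : (a, -1).1 \in _).
rewrite {1 3}/rval /= rmorphN1 => l0 xl; apply: ltW.
by move: xl; rewrite pmulr_lgt0 // lt_def l0 subr_ge0.
Unshelve. all: by end_near.
Qed.

Lemma alcove_ofE p w : base_point D p -> aff_weyl D w ->
  alcove_of D w = cell (w p).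
Proof. by move=> bp wW; rewrite /alcove_of (fund_alcoveE bp) cell_weyl_image. Qed.

(** The effect of a reflection on the distance to a point. *)
Lemma ip_refl_base (q : V * int) l p : q.1 \in Delta D ->
  '(aff_refl D q l - p, aff_refl D q l - p) =
  '(l - p, l - p) + 4 * rval D q l * rval D q p / '(q.1, q.1).
Proof.
move=> qD; have q0 := root_gt0 qD; have qq := lt0r_neq0 q0.
have cc : '(coroot D q.1, coroot D q.1) = 4 / '(q.1, q.1).
  by rewrite ip_coroot ipZl; field.
have cl : '(coroot D q.1, l - p) = 2 * (rval D q l - rval D q p) / '(q.1, q.1).
  by rewrite ip_coroot ipBl /rval; congr (2 * _ / _); ring.
have -> : aff_refl D q l - p = (l - p) - rval D q l *: coroot D q.1.
  by rewrite aff_reflE addrAC.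
move: cc cl; move: (l - p) (coroot D q.1) => u c cc cu.
rewrite ipBl !ipBr !ipZl !ipZr (ipC D u) cc cu.
by field.
Qed.

(** Induction along foldings: reflecting a generic point in walls that
    separate it from the base point terminates, since the distance to the base
    point decreases by an amount bounded below. *)
Lemma fold_ind p (T : V * int -> Prop) (Q : V -> Prop) : base_point D p ->
  (forall q, T q -> aff_simple_root D q) ->
  (forall l, hyperplanes_compl D l -> (forall q, T q -> 0 < rval D q l) -> Q l) ->
  (forall l q, hyperplanes_compl D l -> T q -> rval D q l < 0 ->
     Q (aff_refl D q l) -> Q l) ->
  forall l, hyperplanes_compl D l -> Q l.
Proof.
move=> bp Ts Qbase Qstep l gl.
have [e e0 el] := rval_lb gl; have [f f0 fp] := rval_lb (base_generic bp).
have [a aD|m m0 mle] := @seq_pos_lb _ _ (Delta D) (fun a => '(a, a)^-1).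
  by rewrite invr_gt0 root_gt0.
have d0 : 0 < 4 * e * f * m by rewrite !mulr_gt0.
have : 0 <= '(l - p, l - p) / (4 * e * f * m) by rewrite divr_ge0 ?ip_ge0 // ltW.
move=> /archi_boundP; move: (Num.bound _) => N; rewrite ltr_pdivrMr //.
elim: N l gl el => [|N IHN] l gl el lN.
  by move: lN; rewrite mul0r ltNge ip_ge0.
have [all_pos|/existsNP[q /not_implyP[Tq qneg]]] :=
  pselect (forall q, T q -> 0 < rval D q l); first exact: Qbase.
have qD := aff_simpleD (Ts q Tq); have ql0 := generic_rval gl qD.
have ql : rval D q l < 0 by rewrite lt_neqAle ql0 leNgt; apply/negP.
apply: (Qstep l q) => //; apply: IHN; first exact: generic_refl.
  by move=> r rD; rewrite -rval_act // el // act_root.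
have qp : 0 < rval D q p by apply: base_aff_pos => //; exact/aff_simple_pos/Ts.
rewrite ip_refl_base //; move: lN; rewrite -natr1 mulrDl mul1r.
have := el q qD; have := fp q qD; have := mle _ qD.
rewrite (gtr0_norm qp) (ltr0_norm ql).
move: (rval D q l) (rval D q p) ql qp ('(q.1, q.1)^-1) => x y x0 y0 z zm fy ex.
suff : 4 * e * f * m <= 4 * (- x) * y * z by rewrite mulrN !mulNr; lra.
by rewrite !ler_pM // ?mulr_ge0 // ltW.
Qed.

(** The fundamental alcove is cut out by the simple affine roots. *)
Lemma simple_pos_base l :
  (forall q, aff_simple_root D q -> 0 < rval D q l) -> base_point D l.
Proof.
move=> lpos; have [t th] := highest_root_exists D.
have tl : '(l, t) < 1.
  have := lpos (- t, 1); rewrite /aff_simple_root /= opprK th eqxx orbT.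
  by rewrite /rval /= ipNr => /(_ isT); lra.
have dl : dominant l.
  apply/dominantP => _ /srP[i ->].
  rewrite ipC ip_coroot_gt0 ?srD // ipC.
  have := lpos ((simples D)`_i, 0); rewrite /aff_simple_root /= sr_mem eqxx.
  by rewrite /rval /= addr0 => /(_ isT).
move=> a apos; rewrite dl //= (le_lt_trans _ tl) // -subr_ge0 -ipBr.
case/andP: apos => aD _; case/andP: th => _ /allP/(_ a aD)/nonnegP ta.
rewrite ipC ip_coord sumr_ge0 // => i _; rewrite mulr_ge0 // ltW // ipC dl //.
by rewrite /pos_root srD nonneg_simple.
Qed.

(** The affine Weyl group acts transitively on alcoves. *)
Lemma cell_alcove_of l p : base_point D p -> hyperplanes_compl D l ->
  exists2 w, aff_weyl D w & cell l = alcove_of D w.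
Proof.
move=> bp; move: l.
apply: (@fold_ind p (aff_simple_root D) _ bp)
  => // [l gl lpos|l q gl qs ql [w wW lw]].
  exists id; first exact: aff_weyl_id.
  rewrite (alcove_ofE bp (aff_weyl_id D)) /=; apply: cell_eq; apply: base_cell => //.
  exact: simple_pos_base.
have qD := aff_simpleD qs.
exists (aff_refl D q \o w).
  by apply: aff_weyl_comp => //; exact: aff_weyl_refl.
rewrite /alcove_of -image_comp -[w @` _]lw cell_refl_image // aff_reflK //.
Qed.

End Alcoves.

(** * The Bruhat order relative to a base point *)

Section BaseOrder.
Variables (R : realType) (n : nat) (D : rootData R n).
Local Notation V := 'rV[R]_n.
Local Notation "''(' x , y )" := (inner D x y : R) (format "''(' x ,  y )").

(** The Bruhat order with respect to the alcove of an arbitrary generic point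
    [p], which need not be the fundamental one: a step reflects an alcove in a
    hyperplane that does not separate it from [p]. *)
Inductive ale (p : V) (X : set V) : set V -> Prop :=
| ale_refl : ale p X X
| ale_step Y r : ale p X Y -> r.1 \in Delta D ->
    (forall y, Y y -> 0 < rval D r p * rval D r y) ->
    ale p X (aff_refl D r @` Y).

Lemma aff_refl_imageK q (X : set V) : q.1 \in Delta D ->
  aff_refl D q @` (aff_refl D q @` X) = X.
Proof. by move=> qD; rewrite image_comp aff_reflK_root // image_id. Qed.

Lemma refl_image_act q r (Y : set V) : q.1 \in Delta D -> r.1 \in Delta D ->
  aff_refl D q @` (aff_refl D r @` Y) =
  aff_refl D (act D q r) @` (aff_refl D q @` Y).
Proof.
move=> qD rD; rewrite !image_comp; congr (_ @` _); apply/funext => l /=.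
have := aff_refl_act (aff_refl D q l) qD rD.
by rewrite [X in _ = _ (_ X)](aff_reflK qD).
Qed.

Lemma bruhat_ale p x y : base_point D p -> aff_weyl D x -> bruhat_le D x y ->
  aff_weyl D y /\ ale p (alcove_of D x) (alcove_of D y).
Proof.
move=> bp xW; elim=> [|{}y r _ [yW IHy] rpos len].
  by split=> //; exact: ale_refl.
have rD := aff_pos_rootD rpos.
split; first by apply: aff_weyl_comp => //; exact: aff_weyl_refl.
have [v [_ yK vK]] := aff_weyl_inv yW.
move: len; rewrite (aff_length_refl bp yW rpos (vK p)) => ru.
have [ws wsD yE] := aff_weylP yW.
have -> : alcove_of D (y \o aff_refl D r) =
    aff_refl D (wact D ws r) @` alcove_of D y.
  rewrite /alcove_of image_comp; congr (_ @` _); apply/funext => l /=.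
  by rewrite yE aff_refl_wact.
apply: ale_step => //; first exact: wact_root.
rewrite /alcove_of (fund_alcoveE bp) => _ [f pf <-].
rewrite -{1}(vK p) yE !rval_wact // mulr_gt0 //.
by apply: base_aff_pos => //; exact: cell_base pf.
Qed.

(** A reflection of the alcove of [y] comes from right multiplication of [y] by
    the reflection of the inverse image of the root. *)
Lemma ale_bruhat p x A B : base_point D p -> aff_weyl D x -> A = alcove_of D x ->
  ale p A B ->
  exists y, [/\ aff_weyl D y, B = alcove_of D y & bruhat_le D x y].
Proof.
move=> bp xW Ax; elim=> [|Y r _ [y [yW -> xy]] rD same].
  by exists x; split=> //; exact: bruhat_refl.
have [ws wsD yE] := aff_weylP yW.
have rwsD : rootword D (rev ws) by rewrite /rootword all_rev.
pose v := word_prod D (rev ws); pose r2 := wact D (rev ws) r.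
have yvK : cancel v y by rewrite yE; exact: word_prodK.
have vyK : cancel y v by rewrite yE; exact: word_prodVK.
have r2D : r2.1 \in Delta D by exact: wact_root.
have conj : aff_refl D r \o y = y \o aff_refl D r2.
  apply/funext => l /=; have := aff_refl_wact (y l) rwsD rD.
  by rewrite -/v -/r2 vyK => ->; rewrite yvK.
have r2p : rval D r2 p = rval D r (y p).
  by rewrite -{1}(vyK p) rval_wact.
have r2u : rval D r2 (v p) = rval D r p by rewrite rval_wact.
have yp : alcove_of D y (y p).
  by exists p => //; rewrite (fund_alcoveE bp); exact/cell_refl/base_generic.
have := same _ yp; rewrite -r2p -r2u => sgn.
exists (y \o aff_refl D r2); split.
- by apply: aff_weyl_comp => //; exact: aff_weyl_refl.
- by rewrite /alcove_of image_comp conj.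
have [r2pos|r2neg] := boolP (aff_pos_root D r2).
  apply: bruhat_step => //; rewrite (aff_length_refl bp yW r2pos (yvK p)).
  by move: sgn; rewrite pmulr_lgt0 // base_aff_pos.
have r3pos := aff_posN r2D r2neg; rewrite -aff_reflN.
apply: bruhat_step => //; rewrite (aff_length_refl bp yW r3pos (yvK p)).
have := base_aff_pos bp r3pos; rewrite !rvalN !oppr_gt0 => r2p0.
by move: sgn; rewrite nmulr_lgt0.
Qed.

(** The Bruhat order on alcoves is the order based at the fundamental alcove. *)
Lemma alcove_leP p A B : base_point D p -> alcove D A ->
  alcove_le D A B <-> ale p A B.
Proof.
move=> bp /alcoveP[l gl ->].
split=> [[x [y [xW _ -> -> /(bruhat_ale bp xW)[]//]]]|le].
have [x xW lx] := cell_alcove_of bp gl; rewrite lx in le *.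
by have [y [yW -> xy]] := ale_bruhat bp xW erefl le; exists x, y.
Qed.

Lemma ale_refl_image p X Y q : q.1 \in Delta D -> ale p X Y ->
  ale (aff_refl D q p) (aff_refl D q @` X) (aff_refl D q @` Y).
Proof.
move=> qD; elim=> [|{}Y r _ IH rD same]; first exact: ale_refl.
rewrite refl_image_act //; apply: ale_step => //; first exact: act_root.
by move=> _ [y Yy <-]; rewrite !rval_act // !(aff_reflK qD) same.
Qed.

Lemma ale_translate_all p X Y mu : coweight D mu -> ale p X Y ->
  ale (p + mu) (translate mu X) (translate mu Y).
Proof.
move=> cmu; elim=> [|{}Y r _ IH rD same]; first exact: ale_refl.
pose r' := (r.1, r.2 - Num.floor '(mu, r.1)).
have rv x : rval D r' (x + mu) = rval D r x.
  by rewrite rval_translate //= subrK; case: (r).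
have -> : translate mu (aff_refl D r @` Y) = aff_refl D r' @` translate mu Y.
  rewrite /translate !image_comp; congr (_ @` _); apply/funext => l /=.
  by rewrite !aff_reflE rv addrAC.
by apply: ale_step => // _ [y Yy <-]; rewrite !rv same.
Qed.

(** The base point matters only through its alcove. *)
Lemma ale_cell p q X Y : cell D p q -> ale p X Y -> ale q X Y.
Proof.
move=> pq; elim=> [|{}Y r _ IH rD same]; first exact: ale_refl.
apply: ale_step => // y Yy; apply: pos_mul_trans (same y Yy).
exact: pq.
Qed.

(** The only hyperplane separating the fundamental alcove from its image under
    a simple reflection is the reflecting one. *)
Lemma simple_separates p q r : base_point D p -> aff_simple_root D q ->
  r.1 \in Delta D ->
  [\/ 0 < rval D r p * rval D r (aff_refl D q p), r = q | r = oppr_aff q].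
Proof.
move=> bp qs rD; have qD := aff_simpleD qs.
have pos s : aff_pos_root D s -> s = q \/
    0 < rval D s p * rval D s (aff_refl D q p).
  move=> spos; have [->|sq] := eqVneq s q; [by left | right].
  apply: mulr_gt0; first exact: base_aff_pos.
  rewrite -rval_act ?(aff_pos_rootD spos) //.
  by apply: base_aff_pos => //; exact: act_simple_pos.
have [rpos|/(aff_posN rD) rneg] := boolP (aff_pos_root D r).
  by have [->|] := pos r rpos; [apply: Or32 | apply: Or31].
have [rq|] := pos _ rneg; last by rewrite !rvalN mulrNN; apply: Or31.
by apply: Or33; rewrite -rq /oppr_aff /= !opprK; case: (r).
Qed.

(** Moving the base across one wall. This is the lifting property of the Bruhat
    order: a step in the wall itself exchanges the two alternatives, and the
    other steps preserve each of them. *)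
Lemma ale_cross p X Y q : base_point D p -> aff_simple_root D q -> ale p X Y ->
  ale (aff_refl D q p) X Y \/ ale (aff_refl D q p) X (aff_refl D q @` Y).
Proof.
move=> bp qs; have qD := aff_simpleD qs.
elim=> [|{}Y r _ IH rD same]; first by left; exact: ale_refl.
have [sg|rq] : 0 < rval D r p * rval D r (aff_refl D q p) \/
    aff_refl D r = aff_refl D q.
  by have [|->|->] := simple_separates bp qs rD; rewrite ?aff_reflN;
    [left | right | right].
- case: IH => IH; [left | right].
    apply: ale_step => // y Yy; apply: pos_mul_trans (same y Yy).
    by rewrite mulrC.
  rewrite refl_image_act //; apply: ale_step => //; first exact: act_root.
  by move=> _ [y Yy <-]; rewrite !rval_act // !(aff_reflK qD) same.
- by case: IH => IH; [right | left]; rewrite rq ?aff_refl_imageK.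
Qed.

Lemma ale_cross_up p X Y q : base_point D p -> aff_simple_root D q ->
  (forall y, Y y -> 0 < rval D q y) -> ale p X Y -> ale (aff_refl D q p) X Y.
Proof.
move=> bp qs Yq pXY; have qD := aff_simpleD qs.
have [//|le] := ale_cross bp qs pXY.
rewrite -(aff_refl_imageK Y qD); apply: ale_step => // _ [y Yy <-].
rewrite !rval_refl // mulrNN; apply: mulr_gt0; last exact: Yq.
by apply: base_aff_pos => //; exact: aff_simple_pos.
Qed.

(** The base can be moved from [p] to any point [q] such that no hyperplane
    separates [p] from both [q] and [Y], one wall at a time. *)
Lemma ale_base p q X Y : base_point D p -> hyperplanes_compl D q ->
  (forall r, r.1 \in Delta D -> rval D r p * rval D r q < 0 ->
     forall y, Y y -> 0 < rval D r p * rval D r y) ->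
  ale p X Y -> ale q X Y.
Proof.
move=> bp gq; move: X Y.
apply: (@fold_ind _ _ D p (aff_simple_root D) (fun q => forall X Y, (forall r,
  r.1 \in Delta D -> rval D r p * rval D r q < 0 ->
  forall y, Y y -> 0 < rval D r p * rval D r y) -> ale p X Y -> ale q X Y) bp) => //.
  move=> l gl lpos X Y _; apply: ale_cell; apply: base_cell => //.
  exact: simple_pos_base.
move=> {q gq} l q gl qs ql IH X Y sep pXY; have qD := aff_simpleD qs.
have qp := base_aff_pos bp (aff_simple_pos qs).
have Yq y : Y y -> 0 < rval D q y.
  by move=> /(sep q qD) ; rewrite !pmulr_rlt0 ?pmulr_rgt0 // => ->.
rewrite -[l](aff_reflK qD) -(aff_refl_imageK X qD) -(aff_refl_imageK Y qD).
apply: ale_refl_image => //; apply: IH; last first.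
  rewrite -[p](aff_reflK qD); apply: ale_refl_image => //.
  exact: ale_cross_up.
move=> r rD rpl _ [y Yy <-].
have [sg|rq|rq] := simple_separates bp qs rD; last 2 first.
- move: rpl; rewrite rq rval_refl // mulrN oppr_lt0 pmulr_rgt0 //.
  by rewrite ltNge ltW.
- move: rpl; rewrite rq !rvalN mulrNN rval_refl // mulrN oppr_lt0.
  by rewrite pmulr_rgt0 // ltNge ltW.
have sD := act_root qD rD.
have sp : 0 < rval D r p * rval D (act D q r) p by rewrite rval_act.
rewrite -rval_act //; apply: (pos_mul_trans sp); apply: sep => //.
have := pos_mul_trans (_ : 0 < rval D (act D q r) p * rval D r p)
  (_ : 0 < rval D r p * - rval D (act D q r) l).
rewrite mulrC sp mulrN oppr_gt0 rval_act // rpl => /(_ isT isT).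
by rewrite mulrN oppr_gt0 rval_act.
Qed.

(** Translation by a dominant coweight preserves the Bruhat order below
    dominant alcoves: it amounts to moving the base away from the dominant
    chamber. *)
Lemma ale_translate p X Y mu : base_point D p -> coweight D mu ->
  dominant D mu -> (forall y, Y y -> dominant D y) ->
  ale p X Y -> ale p (translate mu X) (translate mu Y).
Proof.
move=> bp cmu dmu dY pXY; rewrite -{1}(subrK mu p).
apply: ale_translate_all => //; apply: ale_base pXY => //.
  by apply: generic_translate; [exact: coweightN | exact: base_generic].
move=> r rD + y Yy.
have pos s : pos_root D s.1 -> rval D s p * rval D s (p - mu) < 0 ->
    0 < rval D s p * rval D s y.
  move=> spos; have /andP[p0 p1] := bp _ spos; have mu0 := dmu _ spos.
  have y0 := dY _ Yy _ spos.
  have -> : rval D s (p - mu) = rval D s p - '(mu, s.1) by rewrite /rval ipBl; ring.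
  have [sp|sp] := ltP 0 (rval D s p); last first.
    by rewrite ltNge mulr_le0 // subr_le0 (le_trans sp) // ltW.
  move=> _; rewrite mulr_gt0 // /rval ltr_pwDl // ler0z.
  move: sp; rewrite /rval => sp.
  have : -1 < s.2%:~R :> R by lra.
  have -> : -1 = (-1)%:~R :> R by rewrite rmorphN1.
  by rewrite ltr_int; case: (s.2) => -[].
case/orP: (root_sign rD) => r0; first by apply: pos; rewrite /pos_root rD.
have := pos (oppr_aff r); rewrite !rvalN !mulrNN; apply.
by rewrite /pos_root oppr_root.
Qed.

End BaseOrder.

(** * The finite Weyl group and dominance *)

Section FiniteWeyl.
Variables (R : realType) (n : nat) (D : rootData R n).
Local Notation V := 'rV[R]_n.
Local Notation "''(' x , y )" := (inner D x y : R) (format "''(' x ,  y )").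

Lemma fin_reflE a : fin_refl D a = lrefl D a.
Proof. by apply/funext => l; rewrite /fin_refl aff_reflE /rval addr0. Qed.

Lemma fin_weyl_ind (P : (V -> V) -> Prop) : P id ->
  (forall a w, a \in Delta D -> fin_weyl D w -> P w -> P (lrefl D a \o w)) ->
  forall w, fin_weyl D w -> P w.
Proof.
move=> Pid Pstep _ [s sD ->]; elim: s sD => [|a s IHs] //= asD.
have sD : {subset s <= Delta D} by move=> b bs; rewrite asD // in_cons bs orbT.
by rewrite fin_reflE; apply: Pstep (IHs sD); [rewrite asD ?mem_head | exists s].
Qed.

Lemma fin_weyl_id : fin_weyl D id.
Proof. by exists [::]. Qed.

Lemma fin_weyl_lreflM a w : a \in Delta D -> fin_weyl D w ->
  fin_weyl D (lrefl D a \o w).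
Proof.
move=> aD [s sD ->]; exists (a :: s); last by rewrite /= fin_reflE.
by move=> b; rewrite in_cons => /orP[/eqP->|/sD].
Qed.

Lemma fin_weyl_lrefl a : a \in Delta D -> fin_weyl D (lrefl D a).
Proof. by move=> aD; exact: (fin_weyl_lreflM aD fin_weyl_id). Qed.

Lemma fin_weyl_comp v w : fin_weyl D v -> fin_weyl D w -> fin_weyl D (v \o w).
Proof.
move=> vW wW; elim/fin_weyl_ind: v / vW => // a v aD _ vwW.
exact: (fin_weyl_lreflM aD vwW).
Qed.

Lemma fin_aff_weyl w : fin_weyl D w -> aff_weyl D w.
Proof.
elim/fin_weyl_ind => [|a {}w aD _ IHw]; first exact: aff_weyl_id.
apply: aff_weyl_comp => //; rewrite -fin_reflE.
exact: (@aff_weyl_refl _ _ _ (a, 0)).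
Qed.

Lemma fin_weylD w u v : fin_weyl D w -> w (u + v) = w u + w v.
Proof.
elim/fin_weyl_ind => [//|a {}w aD _ IHw] /=.
by rewrite IHw lreflD.
Qed.

Lemma fin_weylZ w c v : fin_weyl D w -> w (c *: v) = c *: w v.
Proof.
elim/fin_weyl_ind => [//|a {}w aD _ IHw] /=.
by rewrite IHw lreflZ.
Qed.

Lemma fin_weylN w v : fin_weyl D w -> w (- v) = - w v.
Proof. by move=> wW; rewrite -scaleN1r fin_weylZ // scaleN1r. Qed.

Lemma fin_weyl_isom w u v : fin_weyl D w -> '(w u, w v) = '(u, v).
Proof.
elim/fin_weyl_ind => [//|a {}w aD _ IHw] /=.
by rewrite lrefl_isom.
Qed.

Lemma fin_weyl_root w a : fin_weyl D w -> a \in Delta D -> w a \in Delta D.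
Proof.
move=> wW aD; elim/fin_weyl_ind: w / wW => [//|b w bD _ IHw] /=.
exact: lrefl_root.
Qed.

Lemma fin_weyl_inv w : fin_weyl D w ->
  exists v, [/\ fin_weyl D v, cancel w v & cancel v w].
Proof.
elim/fin_weyl_ind => [|a {}w aD _ [v [vW wK vK]]].
  by exists id; split=> //; exact: fin_weyl_id.
exists (v \o lrefl D a); split.
- exact: (fin_weyl_comp vW (fin_weyl_lrefl aD)).
- by move=> l /=; rewrite lreflK.
- by move=> l /=; rewrite vK lreflK.
Qed.

Lemma fin_weyl_coroot w a : fin_weyl D w -> coroot D (w a) = w (coroot D a).
Proof. by move=> wW; rewrite /coroot fin_weyl_isom // fin_weylZ. Qed.

Lemma rval_fin_weyl w r x : fin_weyl D w -> rval D (w r.1, r.2) (w x) = rval D r x.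
Proof. by move=> wW; rewrite /rval /= fin_weyl_isom. Qed.

Lemma fin_weyl_refl w r x : fin_weyl D w ->
  w (aff_refl D r x) = aff_refl D (w r.1, r.2) (w x).
Proof.
move=> wW; rewrite !aff_reflE rval_fin_weyl // /= fin_weyl_coroot //.
by rewrite fin_weylD // fin_weylN // fin_weylZ.
Qed.

(** The finite Weyl group acts freely on chambers. *)
Lemma fin_dominant_id p w c : base_point D p -> fin_weyl D w ->
  dominant D c -> dominant D (w c) -> w = id.
Proof.
move=> bp wW dc dwc; have [v [vW wK vK]] := fin_weyl_inv wW.
apply: (aff_weyl_trivial bp (fin_aff_weyl wW) (vK p)) => r rpos.
have rD := aff_pos_rootD rpos; have wrD := fin_weyl_root wW rD.
rewrite -(rval_fin_weyl _ _ wW) vK; apply: base_aff_pos => //.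
move: rpos; rewrite /aff_pos_root /= rD wrD /=.
case/orP=> [->//|/andP[rpos ->]]; apply/orP; right; rewrite andbT.
have := root_sign wrD; rewrite /pos_root wrD => /orP[//|wr0].
have : 0 < '(w c, - w r.1) by apply: dwc; rewrite /pos_root oppr_root.
by rewrite ipNr fin_weyl_isom // oppr_gt0 ltNge ltW // dc.
Qed.

Lemma coroot_nonneg a : pos_root D a -> nonneg_coords D (coroot D a).
Proof.
move=> /andP[aD a0]; apply: nonnegZ => //.
by rewrite divr_ge0 ?ler0n // ltW // root_gt0.
Qed.

(** A generic vector becomes larger when it is moved into the dominant
    chamber. *)
Lemma fold_dominant p l : base_point D p -> hyperplanes_compl D l ->
  exists w, [/\ fin_weyl D w, dominant D (w l) & nonneg_coords D (w l - l)].
Proof.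
move=> bp; move: l.
pose T (q : V * int) := q.1 \in simples D /\ q.2 = 0.
apply: (@fold_ind _ _ D p T _ bp) => [q [qs q0]|l gl lpos|l q gl [qs q0] ql].
- by rewrite /aff_simple_root qs q0 eqxx.
- exists id; rewrite subrr nonneg0; split=> //; first exact: fin_weyl_id.
  apply/dominantP => a as_; rewrite ipC ip_coroot_gt0 ?(simples_Delta as_) // ipC.
  by have := lpos (a, 0) (conj as_ erefl); rewrite /rval /= addr0.
have qD := simples_Delta qs.
have qE : aff_refl D q l = lrefl D q.1 l by rewrite aff_reflE /rval q0 addr0.
rewrite qE => -[w [wW dwl wl0]]; exists (w \o lrefl D q.1); split=> //.
  exact: (fin_weyl_comp wW (fin_weyl_lrefl qD)).
apply: nonneg_trans wl0; rewrite /lrefl addrC addKr -scaleNr nonnegZ //.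
  by rewrite oppr_ge0 ltW //; move: ql; rewrite /rval q0 addr0.
apply: coroot_nonneg; rewrite /pos_root qD.
by have [i ->] := srP qs; exact: nonneg_simple.
Qed.

(** Along the Bruhat order, the dominant conjugates of points increase. *)
Lemma ale_fold p X Y c : base_point D p -> ale D p X Y -> X c ->
  hyperplanes_compl D c -> dominant D c ->
  exists c' w, [/\ Y c', hyperplanes_compl D c', fin_weyl D w, dominant D (w c')
                 & nonneg_coords D (w c' - c)].
Proof.
move=> bp XY Xc gc dc; elim: XY => [|{}Y r _ [c' [w [Yc' gc' wW dwc cc']]] rD same].
  by exists c, id; rewrite subrr nonneg0; split=> //; exact: fin_weyl_id.
wlog wrpos : r rD same / nonneg_coords D (w r.1).
  move=> W; have [r0|r0] := orP (root_sign (fin_weyl_root wW rD)); first exact: W.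
  have := W (oppr_aff r); rewrite aff_reflN; apply.
  - exact: oppr_root.
  - by move=> y Yy; rewrite !rvalN mulrNN same.
  - by rewrite /= fin_weylN.
have wrD := fin_weyl_root wW rD.
have wrp : pos_root D (w r.1) by rewrite /pos_root wrD.
suff [w1 [w1W w1c]] : exists w1, fin_weyl D w1 /\
    nonneg_coords D (w1 (aff_refl D r c') - w c').
  have gs : hyperplanes_compl D (aff_refl D r c') by exact: generic_refl.
  have [w2 [w2W d2 c2]] := fold_dominant bp (generic_weyl (fin_aff_weyl w1W) gs).
  exists (aff_refl D r c'), (w2 \o w1); split=> //.
    exact: (fin_weyl_comp w2W w1W).
  by apply: (nonneg_trans (nonneg_trans cc' w1c)).
have rc' : rval D r c' = '(w c', w r.1) + r.2%:~R.
  by rewrite -(rval_fin_weyl _ _ wW).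
(* with [b = w r.1], the reflected point is conjugate to
   [w c' + r.2 *: coroot b] and to [w c' - rval r c' *: coroot b]; if [r.2 < 0]
   then [rval r] is negative at [p], hence also at [c'] *)
have [r2|r2] := leP 0 r.2.
- exists (lrefl D (w r.1) \o w); split; first exact: fin_weyl_lreflM.
  rewrite /= fin_weyl_refl // aff_reflE /= rval_fin_weyl // rc'.
  rewrite lreflB lreflZ -coroot_lrefl // lrefl_self ?(root_neq0 wrD) // corootN.
  have -> : lrefl D (w r.1) (w c') - ('(w c', w r.1) + r.2%:~R) *: - coroot D (w r.1)
     - w c' = r.2%:~R *: coroot D (w r.1).
    rewrite /lrefl; move: (inner D (w c') (w r.1) : R) (coroot D _) (w c') => x u v.
    by apply/rowP => i; rewrite !mxE; ring.
  by rewrite nonnegZ ?ler0z // coroot_nonneg.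
- exists w; split=> //.
  have rp : rval D r p < 0.
    rewrite -oppr_gt0 -rvalN; apply: base_aff_pos => //.
    by rewrite /aff_pos_root /= oppr_root //= oppr_gt0 r2.
  have rc0 : rval D r c' < 0.
    by have := same c' Yc'; rewrite nmulr_rgt0.
  rewrite fin_weyl_refl // aff_reflE /= rval_fin_weyl //.
  rewrite addrAC subrr add0r -scaleNr nonnegZ ?coroot_nonneg //.
  by rewrite oppr_ge0 ltW.
Qed.

(** For dominant alcoves the Bruhat order implies the dominance order of
    points. *)
Lemma ale_dominant_le p X Y c : base_point D p -> ale D p X Y -> X c ->
  hyperplanes_compl D c -> dominant D c -> (forall y, Y y -> dominant D y) ->
  exists2 c', Y c' & nonneg_coords D (c' - c).
Proof.
move=> bp XY Xc gc dc dY.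
have [c' [w [Yc' _ wW dwc cc']]] := ale_fold bp XY Xc gc dc; exists c' => //.
by move: cc'; rewrite (fin_dominant_id bp wW (dY _ Yc') dwc).
Qed.

(** Two alcoves are joined in the parabolic Bruhat graph if they are related by
    an affine reflection followed by an element of the finite Weyl group. *)
Lemma par_joinedP p A B : base_point D p -> alcove D A -> alcove D B ->
  par_joined D A B <-> A <> B /\ exists w r, [/\ fin_weyl D w, r.1 \in Delta D &
    A = w @` (aff_refl D r @` B)].
Proof.
move=> bp /alcoveP[l gl Al] /alcoveP[m gm Bm]; split.
- move=> [neqAB [x [y [_ yW Ax By [w [r [wW rpos xE]]]]]]]; split=> //.
  have rD := aff_pos_rootD rpos; have [ws wsD yE] := aff_weylP yW.
  exists w, (wact D ws r); split=> //; first exact: wact_root.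
  rewrite Ax By xE /alcove_of !image_comp; congr (_ @` _); apply/funext => z /=.
  by rewrite yE aff_refl_wact.
- move=> [neqAB [w [r [wW rD AE]]]]; split=> //.
  have [y yW By] := cell_alcove_of bp gm; have [ws wsD yE] := aff_weylP yW.
  have rwsD : rootword D (rev ws) by rewrite /rootword all_rev.
  pose r2 := wact D (rev ws) r; have r2D : r2.1 \in Delta D by exact: wact_root.
  have conj z : aff_refl D r (y z) = y (aff_refl D r2 z).
    have := aff_refl_wact (y z) rwsD rD.
    by rewrite yE word_prodVK // -/r2 => ->; rewrite word_prodK.
  have [r3 r3pos r3E] : exists2 r3, aff_pos_root D r3 &
      aff_refl D r3 = aff_refl D r2.
    have [r2pos|/(aff_posN r2D) r3pos] := boolP (aff_pos_root D r2).
      by exists r2.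
    by exists (oppr_aff r2); rewrite ?aff_reflN.
  exists (w \o y \o aff_refl D r3), y; split=> //.
  + apply: aff_weyl_comp; last exact/aff_weyl_refl/aff_pos_rootD.
    exact: (aff_weyl_comp (fin_aff_weyl wW)).
  + rewrite AE Bm By /alcove_of !image_comp; congr (_ @` _); apply/funext => z /=.
    by rewrite r3E conj.
  + by rewrite Bm.
  + by exists w, r3.
Qed.

End FiniteWeyl.

(** * Bounds and finiteness *)

Section Bounds.
Variables (R : realType) (n : nat) (D : rootData R n).
Local Notation V := 'rV[R]_n.
Local Notation "''(' x , y )" := (inner D x y : R) (format "''(' x ,  y )").
Local Notation sr i := ((simples D)`_(i : 'I_n)).

(** The basis dual to the simple roots. *)
Lemma dual_basis : exists u : 'I_n -> V, forall v, v = \sum_i '(v, sr i) *: u i.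
Proof.
pose M : 'M[R]_n := \matrix_(j, i) '(delta_mx 0 j, sr i).
have vM (v : V) i : (v *m M) 0 i = '(v, sr i).
  rewrite mxE [in RHS](row_sum_delta v) ip_suml.
  by apply: eq_bigr => j _; rewrite mxE ipZl.
have Mu : M \in unitmx.
  rewrite -row_free_unit -kermx_eq0; apply/rowV0P => v /sub_kermxP vM0.
  have v0 i : '(v, sr i) = 0 by rewrite -vM vM0 mxE.
  apply: (@ip_eq0 _ _ D); rewrite ip_coord big1 // => i _.
  by rewrite ipC v0 mulr0.
exists (fun i => row i (invmx M)) => v.
rewrite -{1}(mulmxK Mu v) mulmx_sum_row.
by apply: eq_bigr => i _; rewrite vM.
Qed.

Lemma comb_norm (u : 'I_n -> V) (x : 'I_n -> R) c : (forall i, `|x i| <= c) ->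
  '(\sum_i x i *: u i, \sum_i x i *: u i) <=
  \sum_i \sum_j c * (c * `|'(u i, u j)|).
Proof.
move=> xc; rewrite ip_suml; apply: ler_sum => i _.
rewrite ip_sumr; apply: ler_sum => j _; rewrite ipZl ipZr.
apply: le_trans (ler_norm _) _; rewrite !normrM.
by rewrite !ler_pM // mulr_ge0.
Qed.

Lemma norm_split x y : '(x, x) <= 2 * '(y, y) + 2 * '(x - y, x - y).
Proof.
have := ip_ge0 D (x - y - y); rewrite !(ipBl, ipBr) !(ipC D y x).
by move: (inner D x x : R) (inner D x y : R) (inner D y y : R) => a b c; lra.
Qed.

Lemma cell_diam l x y a : cell D l x -> cell D l y -> a \in Delta D ->
  `|'(x - y, a)| <= 1.
Proof.
move=> lx ly aD; have [gl gx] := (cell_generic (cell_sym lx), cell_generic lx).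
rewrite -(cell_eq lx) in ly.
set k := Num.floor '(x, a); have /andP[k0 k1] := floor_itv '(x, a).
rewrite -/k in k0 k1.
have y0 : k%:~R < '(y, a).
  have := ly (a, - k) aD; have := generic_rval gx (aD : (a, - k).1 \in _).
  rewrite /rval /= rmorphN => x0 yx; rewrite -subr_gt0; move: yx.
  by rewrite pmulr_lgt0 // lt_def x0 subr_ge0.
have y1 : '(y, a) < k%:~R + 1.
  have := ly (a, - (k + 1)) aD; rewrite /rval /= rmorphN nmulr_lgt0 ?subr_lt0 //.
  by rewrite rmorphD.
rewrite ipBl ler_norml; rewrite rmorphD /= in k1.
move: k0 k1 y0 y1.
by move: (inner D x a : R) (inner D y a : R) (k%:~R : R) => *; lra.
Qed.

(** The sets all of whose points have square norm at most [K]. *)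
Definition bounded_by (K : R) (E : set V) : Prop := forall x, E x -> '(x, x) <= K.

(** Alcoves are bounded, uniformly. *)
Lemma cell_bounded : exists2 K, 0 <= K & forall l x y, cell D l x -> cell D l y ->
  '(x - y, x - y) <= K /\ forall i, cd D i (x - y) <= K.
Proof.
have [u uE] := dual_basis.
pose K1 : R := \sum_i \sum_j 1 * (1 * `|'(u i, u j)|).
pose K2 : R := \sum_i \sum_j `|cd D j (u i)|.
have K10 : 0 <= K1 by do 2!(rewrite sumr_ge0 // => ? _); rewrite !mul1r.
have K20 : 0 <= K2 by do 2!(rewrite sumr_ge0 // => ? _).
exists (K1 + K2) => [|l x y lx ly]; first exact: addr_ge0.
have b1 i : `|'(x - y, sr i)| <= 1 by apply: cell_diam lx ly _; exact: srD.
split; first by rewrite (uE (x - y)) (le_trans (comb_norm u b1)) // lerDl.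
move=> i; apply: (@le_trans _ _ K2); last by rewrite lerDr.
rewrite {1}(uE (x - y)) cd_sum; apply: ler_sum => j _.
rewrite cdZ (bigD1 i) //= -[leLHS]addr0 lerD ?sumr_ge0 //.
by rewrite (le_trans (ler_norm _)) // normrM ler_piMl.
Qed.

(** The cells that lie between two given ones, in the sense of nonnegative
    coordinates, are uniformly bounded. *)
Lemma between_bounded a b : exists K, forall l e e' x, cell D l e -> cell D l x ->
  cell D b e' -> nonneg_coords D (e - a) -> nonneg_coords D (e' - e) ->
  '(x, x) <= K.
Proof.
have [K1 K10 K1P] := cell_bounded.
pose c := \sum_i (`|cd D i a| + `|cd D i b| + K1).
pose K2 : R := \sum_i \sum_j c * (c * `|'(sr i, sr j)|).
exists (2 * K2 + 2 * K1) => l e e' x le lx be /nonnegP ae /nonnegP ee.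
have ec i : `|cd D i e| <= c.
  apply: (@le_trans _ _ (`|cd D i a| + `|cd D i b| + K1)); last first.
    rewrite /c (bigD1 i) //= lerDl sumr_ge0 // => j _.
    by rewrite !addr_ge0.
  have bb : cell D b b by apply/cell_refl/(cell_generic (cell_sym be)).
  have := (K1P _ _ _ be bb).2 i; have := ae i; have := ee i; rewrite !cdB.
  have := ler_norm (cd D i b); have := ler_normr (cd D i a).
  have := ler_norm (- cd D i a); rewrite normrN => + _.
  rewrite ler_norml; have := normr_ge0 (cd D i a); have := normr_ge0 (cd D i b).
  by move: (cd D i a) (cd D i b) (cd D i e) (cd D i e') => *; lra.
apply: le_trans (norm_split x e) _; rewrite lerD // ler_pM2l ?ltr0n //.
  by rewrite (coordE D e) comb_norm.
exact: (K1P _ _ _ lx le).1.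
Qed.

(** Points of bounded norm become dominant when translated far enough. *)
Lemma dominant_far nu K : dominant D nu -> exists M : int,
  forall m x, M <= m -> '(x, x) <= K -> dominant D (x + nu *~ m).
Proof.
move=> dnu.
pose f (a : V) : R := if pos_root D a then '(nu, a) / (`|K| + '(a, a)) else 1.
have fpos a : a \in Delta D -> 0 < f a.
  rewrite /f => aD; case: ifP => // apos.
  by rewrite divr_gt0 ?dnu // ltr_wpDl ?root_gt0.
have [e e0 ele] := @seq_pos_lb _ _ (Delta D) f fpos.
exists (Num.bound e^-1)%:Z => m x Mm xK a apos.
have aD : a \in Delta D by case/andP: apos.
have := ele a aD; rewrite /f apos ler_pdivlMr; last by rewrite ltr_wpDl ?root_gt0.
have m1 : 1 <= m%:~R * e.
  rewrite -ler_pdivrMr // mul1r; apply: ltW.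
  apply: lt_le_trans (archi_boundP _) _; first by rewrite invr_ge0 ltW.
  by rewrite -[leLHS]/((Num.bound e^-1)%:Z%:~R) ler_int.
have Ka : 0 < `|K| + '(a, a) by rewrite ltr_wpDl ?root_gt0.
move=> le; rewrite ipDl -scaler_int ipZl.
have m0 : 0 <= m%:~R :> R by rewrite ler0z (le_trans _ Mm).
have : `|K| + '(a, a) <= m%:~R * '(nu, a).
  apply: le_trans (ler_wpM2l m0 le); rewrite mulrA ler_peMl // ltW //.
(* [2 (x, a) >= - (x, x) - (a, a)] *)
have := ip_ge0 D (x + a); rewrite ipDl !ipDr (ipC D a x).
have := le_trans xK (ler_norm K); have := root_gt0 aD.
move: Ka.
move: (inner D x x : R) (inner D x a : R) (inner D a a : R) (m%:~R * _ : R) => *.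
lra.
Qed.

(** An alcove is determined by the integer parts of the roots on it, among
    which only finitely many occur in a bounded region. *)
Lemma floor_cell l x : hyperplanes_compl D l -> hyperplanes_compl D x ->
  (forall a, a \in Delta D -> Num.floor '(x, a) = Num.floor '(l, a)) ->
  cell D l x.
Proof.
move=> gl gx fl r rD.
have := generic_rval gl rD; have := generic_rval gx rD; rewrite /rval => x0 l0.
have fr y : (- r.2 <= Num.floor '(y, r.1)) = (0 <= '(y, r.1) + r.2%:~R).
  by rewrite floor_ge_int rmorphN -subr_ge0 opprK.
have := fr x; rewrite fl // fr.
move: x0 l0; move: (_ + _) (_ + _) => v u.
case: (ltgtP u 0) => [u0|u0|->]; rewrite ?eqxx // => _;
  case: (ltgtP v 0) => [v0|v0|->]; rewrite ?eqxx // => _ _.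
  by rewrite nmulr_rgt0.
by rewrite pmulr_rgt0.
Qed.

Lemma cell_floor l x a : cell D l x -> a \in Delta D ->
  Num.floor '(x, a) = Num.floor '(l, a).
Proof.
move=> lx aD; apply: le_anti.
have le y z : cell D y z -> Num.floor '(y, a) <= Num.floor '(z, a).
  move=> yz; rewrite floor_ge_int; have := yz (a, - Num.floor '(y, a)) aD.
  have gy := cell_generic (cell_sym yz).
  have := generic_rval gy (aD : (a, - Num.floor '(y, a)).1 \in _).
  rewrite /rval /= rmorphN => y0; rewrite pmulr_lgt0 ?subr_gt0; first exact: ltW.
  by rewrite -subr_gt0 lt_def y0 subr_ge0 floor_le.
by rewrite !le //; exact: cell_sym.
Qed.

Lemma finitely_many_cells K : exists S : seq (set V), forall l,
  hyperplanes_compl D l -> bounded_by K (cell D l) -> cell D l \in S.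
Proof.
pose C : R := `|K| + \sum_(b <- Delta D) '(b, b).
have Cle x a : '(x, x) <= K -> a \in Delta D -> `|'(x, a)| <= C.
  move=> xK aD; have aC : '(a, a) <= \sum_(b <- Delta D) '(b, b).
    rewrite (big_rem a) //= lerDl sumr_ge0 // => b _; exact: ip_ge0.
  have := ip_ge0 D (x + a); rewrite ipDl !ipDr (ipC D a x).
  have := ip_ge0 D (x - a); rewrite ipBl !ipBr (ipC D a x).
  have := ler_norm K; have := root_gt0 aD; have := ip_ge0 D x.
  rewrite ler_norml /C; move: xK aC.
  move: (\sum_(_ <- _) _) (inner D x x : R) (inner D x a : R) (inner D a a : R) => *.
  lra.
have C0 : 0 <= C by rewrite addr_ge0 // sumr_ge0 // => b _; exact: ip_ge0.
pose N := Num.bound C; have CN : C < N%:~R by exact: archi_boundP.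
pose F (phi : {ffun Delta D -> 'I_(N + N).+1}) : set V := [set x |
  hyperplanes_compl D x /\
  forall a : Delta D, Num.floor '(x, val a) = (phi a : nat)%:Z - N%:Z].
exists [seq F phi | phi <- enum {ffun Delta D -> 'I_(N + N).+1}] => l gl lK.
(* the integer parts lie between [- N] and [N]; they are stored shifted by [N] *)
pose phi := [ffun a : Delta D =>
  inord (absz (Num.floor '(l, val a) + N%:Z)) : 'I_(N + N).+1].
have phiE (a : Delta D) : (phi a : nat)%:Z - N%:Z = Num.floor '(l, val a).
  have := Cle l (val a) (lK _ (cell_refl gl)) (valP a).
  rewrite ler_norml => /andP[Cl lC].
  have lo : - N%:Z <= Num.floor '(l, val a).
    by rewrite floor_ge_int rmorphN (le_trans _ Cl) // lerN2 ltW.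
  have hi : Num.floor '(l, val a) <= N%:Z.
    rewrite -(ler_int R) (le_trans (floor_le _)) // (le_trans lC) //.
    exact: ltW.
  rewrite ffunE inordK; first by lia.
  by lia.
suff -> : cell D l = F phi by apply: map_f; rewrite mem_enum.
apply/seteqP; split=> x.
  move=> lx; split; first exact: cell_generic lx.
  by move=> a; rewrite phiE; apply: cell_floor lx (valP a).
move=> [gx xphi]; apply: floor_cell => // a aD.
by have := xphi [` aD]%fset; rewrite phiE.
Qed.

(** The orbit of a vector under the finite Weyl group is finite, an element of
    this group being determined by the images of the simple roots. *)
Lemma fin_weyl_orbit nu : exists s : seq V, forall w, fin_weyl D w -> w nu \in s.
Proof.
pose F (phi : {ffun 'I_n -> Delta D}) : V := \sum_i cd D i nu *: val (phi i).
exists [seq F phi | phi <- enum {ffun 'I_n -> Delta D}] => w wW.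
have wD i : w (sr i) \in Delta D by apply: fin_weyl_root => //; exact: srD.
suff -> : w nu = F [ffun i => [` wD i]%fset] by apply: map_f; rewrite mem_enum.
rewrite /F {1}(coordE D nu).
rewrite (big_morph w (fun u v => fin_weylD u v wW) (_ : w 0 = 0)); last first.
  by rewrite -[X in w X](scale0r 0) (fin_weylZ _ _ wW) scale0r.
by apply: eq_bigr => i _; rewrite ffunE (fin_weylZ _ _ wW).
Qed.

(** If [E1] and [E2], translated far into the dominant chamber, are related by
    an affine reflection followed by an element [w] of the finite Weyl group,
    then [w] is trivial or it is the reflection in the same direction: else
    [w nu - nu] is not on the line spanned by [w r.1], and the translates are
    moved too far apart. *)
Lemma joined_far p nu K : base_point D p -> dominant D nu -> exists M : int,
  forall m E1 E2 w r x, M <= m -> bounded_by K E1 -> bounded_by K E2 -> E2 x ->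
  fin_weyl D w -> r.1 \in Delta D ->
  translate (nu *~ m) E1 = w @` (aff_refl D r @` translate (nu *~ m) E2) ->
  w = id \/ w = lrefl D (w r.1).
Proof.
move=> bp dnu; have [U UP] := fin_weyl_orbit nu.
(* for [ub = (u, b)], the part of [nu - u] orthogonal to [b] *)
pose g (ub : V * V) := nu - ub.1 - ('(nu - ub.1, ub.2) / '(ub.2, ub.2)) *: ub.2.
pose f ub := if g ub == 0 then 1 else '(g ub, g ub).
have fpos ub : ub \in [seq (u, b) | u <- U, b <- Delta D] -> 0 < f ub.
  by move=> _; rewrite /f; case: eqVneq => // /(ip_gt0 D).
have [e e0 ele] := seq_pos_lb fpos.
pose M := Num.bound ((4 * `|K| + 1) / e).
exists M.+1%:Z => m E1 E2 w r x Mm E1K E2K E2x wW rD eqE.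
have bD := fin_weyl_root wW rD; set b := w r.1 in bD *; set u := w nu.
have b0 := root_gt0 bD.
have [y E1y yE] : exists2 y, E1 y &
    y + nu *~ m = w (aff_refl D r (x + nu *~ m)).
  have : (translate (nu *~ m) E1) (w (aff_refl D r (x + nu *~ m))).
    rewrite eqE; exists (aff_refl D r (x + nu *~ m)) => //.
    by exists (x + nu *~ m) => //; exists x.
  by move=> [y E1y yE]; exists y.
have {}yE : m%:~R *: (nu - u) + rval D r (x + nu *~ m) *: coroot D b = w x - y.
  move: yE; rewrite fin_weyl_refl // aff_reflE /= rval_fin_weyl // -/b.
  rewrite (fin_weylD _ _ wW) -scaler_int (fin_weylZ _ _ wW) -/u => /eqP.
  rewrite -subr_eq0 => /eqP yE; apply/eqP; rewrite -subr_eq0 -yE; apply/eqP.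
  move: (rval _ _ _) (coroot D b) (w x) => k c z.
  by apply/rowP => i; rewrite !mxE; ring.
(* the right-hand side is bounded, while on the left [m *: (nu - u)] grows
   unless [nu - u] is a multiple of [b] *)
have wxy : '(w x - y, w x - y) <= 4 * `|K|.
  have := norm_split (w x - y) (w x); rewrite addrAC subrr sub0r.
  rewrite (fin_weyl_isom x x wW) ipNl ipNr opprK.
  have := E1K _ E1y; have := E2K _ E2x; have := ler_norm K.
  by move: (inner D y y : R) (inner D x x : R) (inner D _ _ : R) => *; lra.
have g0 : g (u, b) = 0.
  apply/eqP/negPn/negP => gn0.
  have := ele (u, b); rewrite /f (negbTE gn0).
  rewrite (allpairs_f pair (UP w wW) bD) => /(_ isT) eg.
  have gb : '(g (u, b), b) = 0.
    by rewrite /g /= ipBl ipZl divfK ?subrr // lt0r_neq0.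
  have wxyE : w x - y = m%:~R *: g (u, b) +
      (m%:~R * ('(nu - u, b) / '(b, b)) +
       rval D r (x + nu *~ m) * (2 / '(b, b))) *: b.
    rewrite -yE /coroot /g /=; move: (rval _ _ _) (_ / _) (_ / _) => k c z.
    by apply/rowP => i; rewrite !mxE; ring.
  have : m%:~R ^+ 2 * '(g (u, b), g (u, b)) <= 4 * `|K|.
    apply: le_trans wxy; rewrite wxyE; move: (m%:~R * _ + _) => c.
    move: (g (u, b)) gb => h hb; rewrite ipDl !ipDr !ipZl !ipZr (ipC D b) hb.
    have : 0 <= c ^+ 2 * '(b, b) by rewrite mulr_ge0 ?sqr_ge0 // ltW.
    move: (inner D b b : R) (inner D h h : R) (m%:~R : R) => *; lra.
  apply/negP; rewrite -ltNge.
  have mM : M.+1%:R <= m%:~R :> R by rewrite -[leLHS]/(M.+1%:Z%:~R) ler_int.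
  have m1 : 1 <= m%:~R :> R by rewrite (le_trans _ mM) // ler1n.
  have : (4 * `|K| + 1) / e < m%:~R.
    apply: lt_le_trans mM; apply: (@lt_trans _ _ M%:R); last by rewrite ltr_nat.
    by apply: archi_boundP; rewrite divr_ge0 ?addr_ge0 ?mulr_ge0 // ltW.
  rewrite ltr_pdivrMr // => meK.
  apply: (@lt_le_trans _ _ (m%:~R * e)); first by lra.
  rewrite ler_pM ?(ltW e0) ?(le_trans ler01 m1) //.
  by rewrite expr2 ler_peMl // (le_trans ler01 m1).
pose c := '(nu - u, b) / '(b, b).
have uE : u = nu - c *: b.
  move/eqP: g0; rewrite /g /= subr_eq0 => /eqP nub.
  by rewrite -/c in nub; rewrite -nub opprB subrKC.
(* a vector of the same norm as [nu] on the line through [nu] directed by [b]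
   is [nu] or its reflection *)
have : '(u, u) = '(nu, nu) by exact: fin_weyl_isom.
rewrite uE ipBl !ipBr !ipZl !ipZr (ipC D b nu) => normE.
have : c * (c * '(b, b) - 2 * '(nu, b)) = 0.
  move: normE; move: (inner D b b : R) (inner D nu b : R) (inner D nu nu : R) => *.
  lra.
move=> /eqP; rewrite mulf_eq0 => /orP[/eqP c0|/eqP cE].
  left; apply: (fin_dominant_id bp wW dnu).
  by rewrite -/u uE c0 scale0r subr0.
right; have unu : u = lrefl D b nu.
  rewrite uE lreflE ip_coroot; congr (_ - _ *: _).
  by rewrite -(subr0_eq cE) mulfK // lt0r_neq0.
have bwid : lrefl D b \o w = id.
  apply: (fin_dominant_id bp (fin_weyl_lreflM bD wW) dnu).
  by rewrite /= -/u unu lreflK.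
apply/funext => z; have := congr1 (fun h => lrefl D b (h z)) bwid.
by rewrite /= lreflK.
Qed.

(** In both cases of [joined_far] the relation is invariant under translation by
    coweights: in the second one [w \o aff_refl r] is itself a translation. *)
Lemma joined_translate w r A B mu : fin_weyl D w -> r.1 \in Delta D ->
  w = id \/ w = lrefl D (w r.1) -> coweight D mu ->
  A = w @` (aff_refl D r @` B) ->
  exists2 r', r'.1 \in Delta D &
    translate mu A = w @` (aff_refl D r' @` translate mu B).
Proof.
move=> wW rD wE cmu ->; case: wE => [->|].
  exists (r.1, r.2 - Num.floor '(mu, r.1)) => //.
  rewrite /translate !image_comp; congr (_ @` _); apply/funext => x /=.
  rewrite !aff_reflE rval_translate //= subrK addrAC.
  by case: (r).
have bD := fin_weyl_root wW rD; move: bD; set b := w r.1 => bD wE.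
have rb : r.1 = - b.
  have br : lrefl D b r.1 = b by rewrite -wE.
  by rewrite -[LHS](lreflK bD) br lrefl_self // (root_neq0 bD).
have wr z : w (aff_refl D r z) = z - (r.2)%:~R *: coroot D b.
  rewrite wE aff_reflE rb corootN /rval rb ipNr scalerN opprK lreflD lreflZ.
  rewrite -coroot_lrefl // lrefl_self ?(root_neq0 bD) // corootN /lrefl.
  move: (inner D z b : R) (coroot D b) => c u.
  by apply/rowP => i; rewrite !mxE; ring.
exists r => //; rewrite /translate !image_comp; congr (_ @` _); apply/funext => x /=.
by rewrite -/b !wr addrAC.
Qed.

End Bounds.

(** * Stabilization under translation *)

(** A property that persists as the parameter grows is eventually constant, with
    a common threshold for finitely many properties. *)
Lemma monotone_stabilizes (T : eqType) (S : seq T) (Q : T -> int -> Prop)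
    (valid : int -> Prop) (M : int) :
  (forall t m m', valid m -> valid m' -> M <= m -> m <= m' -> Q t m -> Q t m') ->
  exists2 m0, M <= m0 & forall t m m', t \in S -> valid m -> valid m' ->
    m0 <= m -> m0 <= m' -> Q t m -> Q t m'.
Proof.
move=> mono; elim: S => [|t S [m0 Mm0 IHS]]; first by exists M.
have [m1 Mm1 m1P] : exists2 m1, M <= m1 & forall m m', valid m -> valid m' ->
    m1 <= m -> m1 <= m' -> Q t m -> Q t m'.
  have [[m1 [v1 Mm1 q1]]|no] := pselect (exists m1, [/\ valid m1, M <= m1 & Q t m1]).
    by exists m1 => // m m' _ v' _ mm' _; exact: mono mm' q1.
  exists M => // m m' v _ Mm _ q; case: no; by exists m.
exists (Num.max m0 m1); first by rewrite le_max Mm0.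
move=> u m m'; rewrite in_cons !ge_max => /orP[/eqP ->|uS] v v'
  /andP[m0m m1m] /andP[m0m' m1m'].
  exact: m1P.
exact: IHS.
Qed.

Section Translates.
Variables (R : realType) (n : nat) (D : rootData R n).
Local Notation V := 'rV[R]_n.
Local Notation "''(' x , y )" := (inner D x y : R) (format "''(' x ,  y )").

Lemma translateD (x y : V) (X : set V) :
  translate y (translate x X) = translate (x + y) X.
Proof.
rewrite /translate image_comp; congr (_ @` _); apply/funext => z /=.
by rewrite addrA.
Qed.

Lemma translate0 (X : set V) : translate 0 X = X.
Proof.
rewrite /translate -[RHS]image_id; congr (_ @` _); apply/funext => z.
by rewrite addr0.
Qed.

Lemma translate_inj (x : V) : injective (translate x).
Proof.
by move=> X Y /(congr1 (translate (- x))); rewrite !translateD subrr !translate0.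
Qed.

Lemma coweightB x y : coweight D x -> coweight D y -> coweight D (x - y).
Proof. by move=> cx cy a aD; rewrite ipBl rpredB ?cx ?cy. Qed.

Lemma alcove_translate mu A : coweight D mu -> alcove D A ->
  alcove D (translate mu A).
Proof.
move=> cmu /alcoveP[l gl ->]; rewrite cell_translate //.
by apply: alcove_cell; exact: generic_translate.
Qed.

Lemma dominant_scale nu (m : int) : dominant D nu -> 0 < m -> dominant D (nu *~ m).
Proof.
by move=> dnu m0 a apos; rewrite -scaler_int ipZl mulr_gt0 ?ltr0z ?dnu.
Qed.

Lemma exists_base_point nu : dominant D nu -> exists p, base_point D p.
Proof.
move=> dnu; pose f a : R := if pos_root D a then (2 * '(nu, a))^-1 else 1.
have [a aD|e e0 ele] := @seq_pos_lb _ _ (Delta D) f.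
  by rewrite /f; case: ifP => // apos; rewrite invr_gt0 mulr_gt0 ?dnu.
exists (e *: nu) => a apos; have aD : a \in Delta D by case/andP: apos.
have := ele a aD; rewrite /f apos ipZl mulr_gt0 ?dnu //= => ea.
rewrite -ltr_pdivlMr ?dnu // mul1r (le_lt_trans ea) //.
rewrite ltf_pV2 ?posrE ?mulr_gt0 ?dnu //.
by rewrite mulr_natl mulr2n ltrDl dnu.
Qed.

Lemma dominant_of_scale nu (m : int) : 0 < m -> dom_chamber D (nu *~ m) ->
  dominant D nu.
Proof.
move=> m0 /dominantP dm a /dm; rewrite -scaler_int ipZl.
by rewrite pmulr_rgt0 ?ltr0z.
Qed.

(** A Bruhat relation between two translates by [nu *~ m], the larger of which is
    dominant, persists as [m] grows. *)
Lemma alcove_le_translate p nu X Y (m m' : int) : base_point D p ->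
  dominant D nu -> coweight D (nu *~ m) -> coweight D (nu *~ m') -> m <= m' ->
  alcove D X -> (forall y, Y y -> dominant D (y + nu *~ m)) ->
  alcove_le D (translate (nu *~ m) X) (translate (nu *~ m) Y) ->
  alcove_le D (translate (nu *~ m') X) (translate (nu *~ m') Y).
Proof.
move=> bp dnu cm cm' mm' aX dY; have [->//|neq_mm'] := eqVneq m m'.
have mE : nu *~ m' = nu *~ m + nu *~ (m' - m) by rewrite -mulrzDr subrKC.
have cd' : coweight D (nu *~ (m' - m)) by rewrite mulrzBr; exact: coweightB.
move/(alcove_leP _ bp (alcove_translate cm aX)) => le.
apply/(alcove_leP _ bp (alcove_translate cm' aX)); rewrite mE -!translateD.
apply: ale_translate le => //; last by move=> _ [y Yy <-]; exact: dY.
by apply: dominant_scale; rewrite ?subr_gt0 ?lt_neqAle ?neq_mm'.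
Qed.

(** Translated back by [- nu *~ m], the members of the interval between the
    translates of two dominant alcoves stay in a region that does not depend on
    [m]. *)
Lemma interval_bounded p nu a b : base_point D p -> dominant D nu ->
  hyperplanes_compl D a -> dominant D a -> hyperplanes_compl D b ->
  dominant D b -> exists K, forall (m : int) E, 0 < m -> coweight D (nu *~ m) ->
  alcove_itv D (translate (nu *~ m) (cell D a)) (translate (nu *~ m) (cell D b)) E ->
  exists l, [/\ hyperplanes_compl D l, bounded_by D K (cell D l) &
                E = translate (nu *~ m) (cell D l)].
Proof.
move=> bp dnu ga da gb db; have [K KP] := between_bounded D a b.
exists K => m E m0 cm [dE AE EB]; set t := nu *~ m in cm AE EB *.
have dt : dominant D t by exact: dominant_scale.
have aE : alcove D E by case: dE.
have [e0 ge0 Ee0] := (alcoveP D E).1 aE.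
have aA : alcove D (translate t (cell D a)) by apply/alcove_translate/alcove_cell.
have dEy e : E e -> dominant D e by move=> Ee; apply/dominantP; exact: dE.2.
have Aa : translate t (cell D a) (a + t) by exists a => //; exact: cell_refl.
have [e Ee ae] := ale_dominant_le bp ((alcove_leP _ bp aA).1 AE) Aa
  (generic_translate cm ga) (dominantD da dt) dEy.
have ge : hyperplanes_compl D e by rewrite Ee0 in Ee; exact: cell_generic Ee.
have dBy y : translate t (cell D b) y -> dominant D y.
  by move=> [z bz <-]; apply: dominantD => //; exact: cell_dominant bz db.
have leEB := (alcove_leP _ bp aE).1 EB.
have [_ [b1 bb1 <-] eb] := ale_dominant_le bp leEB Ee ge (dEy _ Ee) dBy.
exists (e0 - t); split.
- by apply: generic_translate => //; exact: coweightN.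
- move=> x lx; apply: (KP (e0 - t) (e - t) b1) => //.
  + rewrite -(cell_translate _ (coweightN cm)) -Ee0; by exists e.
  + by rewrite -addrA -opprD [t + a]addrC.
  + by rewrite opprB addrA.
- by rewrite cell_translate // subrK.
Qed.

End Translates.

Theorem lemma4p2 (R : realType) (n : nat) (D : rootData R n)
    (A B : set 'rV[R]_n) :
  dom_alcove D A -> dom_alcove D B -> alcove_le D A B ->
  exists m0 : int, forall (m1 m2 : int) (l1 l2 : 'rV[R]_n),
    m0 <= m1 -> m0 <= m2 ->
    l1 = rho D *~ m1 -> l2 = rho D *~ m2 ->
    (coweight D `&` dom_chamber D) l1 -> (coweight D `&` dom_chamber D) l2 ->
    full_subgraph_iso (par_edge D)
      (alcove_itv D (translate l1 A) (translate l1 B))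
      (alcove_itv D (translate l2 A) (translate l2 B)).
Proof.
(* if [rho] is not dominant, then neither are its positive multiples and the
   hypotheses on [l1] cannot hold *)
move=> domA domB _; have [dnu|ndnu] := pselect (dominant D (rho D)); last first.
  exists 1 => m1 m2 l1 l2 m1_ge1 _ l1E _ [_ dl1] _; case: ndnu.
  apply: (@dominant_of_scale _ _ _ _ m1); last by rewrite -l1E.
  exact: lt_le_trans m1_ge1.
set nu := rho D in dnu *.
have [p bp] := exists_base_point dnu.
have [a ga AE] : exists2 a, hyperplanes_compl D a & A = cell D a.
  by apply/alcoveP; case: domA.
have [b gb BE] : exists2 b, hyperplanes_compl D b & B = cell D b.
  by apply/alcoveP; case: domB.
subst A B.
have da := (dom_alcove_cell ga).1 domA; have db := (dom_alcove_cell gb).1 domB.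
have [K KP] := interval_bounded bp dnu ga da gb db.
have [S SP] := finitely_many_cells D K.
have [M1 M1P] := dominant_far K dnu.
have [M2 M2P] := joined_far K bp dnu.
pose M := Num.max 1 (Num.max M1 M2).
have MP m : M <= m -> [/\ 0 < m, M1 <= m & M2 <= m].
  by rewrite !ge_max => /and3P[m1 -> ->]; split=> //; exact: lt_le_trans m1.
pose T (m : int) X := translate (nu *~ m) X.
pose valid m := coweight D (nu *~ m).
(* all translates of [Y] that are considered are dominant *)
pose stays (Y : set _) := forall m y, M <= m -> Y y -> dominant D (y + nu *~ m).
pose Q (XY : set 'rV[R]_n * set 'rV[R]_n) m :=
  [/\ alcove D XY.1, stays XY.2 & alcove_le D (T m XY.1) (T m XY.2)].
pose S' := cell D a :: cell D b :: S.
pose pairs := [seq (X, Y) | X <- S', Y <- S'].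
have [|m0 Mm0 m0P] := @monotone_stabilizes _ pairs Q valid M.
  move=> [X Y] m m' v v' Mm mm' [aX sY le]; split=> //.
  by apply: (alcove_le_translate bp dnu v v' mm' aX) => // y; exact: sY.
have dom_stays c : dominant D c -> stays (cell D c).
  move=> dc m y /MP[m_gt0 _ _] cy.
  by apply: dominantD; [exact: cell_dominant cy dc | exact: dominant_scale].
have bounded_stays Y : bounded_by D K Y -> stays Y.
  by move=> YK m y /MP[_ Mm _] /YK; exact: M1P.
(* the alcoves whose translates are the vertices of the intervals *)
pose vertex X := exists l,
  [/\ hyperplanes_compl D l, bounded_by D K X & X = cell D l].
have vertex_S X : vertex X -> X \in S'.
  by move=> [l [gl XK Xl]]; rewrite !in_cons Xl SP ?orbT // -Xl.
have vertex_alcove X : vertex X -> alcove D X.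
  by move=> [l [gl _ ->]]; exact: alcove_cell.
have le_transfer X Y m m' : X \in S' -> Y \in S' -> alcove D X -> stays Y ->
    m0 <= m -> m0 <= m' -> valid m -> valid m' ->
    alcove_le D (T m X) (T m Y) -> alcove_le D (T m' X) (T m' Y).
  move=> XS YS aX sY m0m m0m' v v' le.
  have XYS : (X, Y) \in pairs by exact: allpairs_f.
  by have [] := m0P (X, Y) m m' XYS v v' m0m m0m' (And3 aX sY le).
have AS : cell D a \in S' by rewrite mem_head.
have BS : cell D b \in S' by rewrite in_cons mem_head orbT.
have itv_vertex m E : m0 <= m -> valid m ->
    alcove_itv D (T m (cell D a)) (T m (cell D b)) E ->
    exists2 X, vertex X & E = T m X.
  move=> /(le_trans Mm0)/MP[m_gt0 _ _] v /(KP m E m_gt0 v)[l [gl lK ->]].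
  by exists (cell D l) => //; exists l.
have itv_transfer X m m' : vertex X -> m0 <= m -> m0 <= m' -> valid m -> valid m' ->
    alcove_itv D (T m (cell D a)) (T m (cell D b)) (T m X) ->
    alcove_itv D (T m' (cell D a)) (T m' (cell D b)) (T m' X).
  move=> vX m0m m0m' v v' [_ aX Xb].
  have [l [gl XK Xl]] := vX; have sX := bounded_stays _ XK.
  split.
  - rewrite /T Xl cell_translate //; apply/dom_alcove_cell.
      exact: generic_translate.
    by apply: sX (le_trans Mm0 m0m') _; rewrite Xl; exact: cell_refl.
  - apply: (le_transfer _ _ m) => //; first exact: vertex_S.
    exact: alcove_cell.
  - apply: (le_transfer _ _ m) => //; first exact: vertex_S.
      exact: vertex_alcove.
    exact: dom_stays.
have joined_transfer X Y m m' : vertex X -> vertex Y -> m0 <= m -> m0 <= m' ->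
    valid m -> valid m' ->
    par_joined D (T m X) (T m Y) -> par_joined D (T m' X) (T m' Y).
  move=> vX vY m0m m0m' v v'.
  have aX := vertex_alcove _ vX; have aY := vertex_alcove _ vY.
  move=> /(par_joinedP bp (alcove_translate v aX) (alcove_translate v aY)).
  move=> [neq [w [r [wW rD XY]]]].
  apply/(par_joinedP bp (alcove_translate v' aX) (alcove_translate v' aY)).
  split; first by move=> /translate_inj XeY; apply: neq; rewrite XeY.
  have [_ _ Mm] := MP _ (le_trans Mm0 m0m).
  have [lX [_ XK _]] := vX; have [lY [gY YK YE]] := vY.
  have YlY : Y lY by rewrite YE; exact: cell_refl.
  have wE := M2P m X Y w r lY Mm XK YK YlY wW rD XY.
  have cmu : coweight D (nu *~ m' - nu *~ m) by exact: coweightB.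
  have [r' r'D] := joined_translate wW rD wE cmu XY.
  by rewrite !translateD subrKC => XY'; exists w, r'.
have edge_transfer X Y m m' : vertex X -> vertex Y -> m0 <= m -> m0 <= m' ->
    valid m -> valid m' ->
    par_edge D (T m X) (T m Y) -> par_edge D (T m' X) (T m' Y).
  move=> vX vY m0m m0m' v v' [jXY leXY]; split; first exact: (joined_transfer _ _ m).
  apply: (le_transfer _ _ m) => //; try exact: vertex_S; first exact: vertex_alcove.
  by case: vY => l [_ YK _]; exact: bounded_stays.
exists m0 => m1 m2 _ _ m01 m02 -> -> [v1 _] [v2 _].
have fE X : translate (nu *~ m2 - nu *~ m1) (T m1 X) = T m2 X.
  by rewrite translateD subrKC.
exists (translate (nu *~ m2 - nu *~ m1)).
  split=> [E itvE|E E' _ _|E itvE]; last 2 first.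
  - exact: translate_inj.
  - have [X vX EX] := itv_vertex _ _ m02 v2 itvE; rewrite EX in itvE *.
    exists (T m1 X); last exact: fE.
    exact: itv_transfer itvE.
  - have [X vX EX] := itv_vertex _ _ m01 v1 itvE; rewrite EX in itvE *.
    by rewrite fE; exact: itv_transfer itvE.
move=> E E' /(itv_vertex _ _ m01 v1)[X vX ->] /(itv_vertex _ _ m01 v1)[Y vY ->].
by rewrite !fE; split; exact: edge_transfer.
Qed.
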